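(* Let $N \ge 1$, let $a<b$ be real numbers, and let $\mathbf{p},\mathbf{q}\in\mathbb{R}^N$. Let $\mathscr{P}$ be the diffeological space of smooth paths $[a,b]\to\mathbb{R}^N$ and $\mathscr{P}_{\mathbf{p},\mathbf{q}}\subseteq \mathscr{P}$ the diffeological subspace of paths $\gamma$ with $\gamma(a)=\mathbf{p}$ and $\gamma(b)=\mathbf{q}$. For any $\gamma\in\mathscr{P}$, there is an isomorphism of real vector spaces $$\mathrm{D}\colon \mathscr{P}\overset{\cong}{\longrightarrow}\mathrm{T}_\gamma\mathscr{P}.$$ Similarly, for any $\gamma\in\mathscr{P}_{\mathbf{p},\mathbf{q}}$, there is an isomorphism of real vector spaces $$\mathrm{D}\colon \mathscr{P}_{\mathbf{0},\mathbf{0}}\overset{\cong}{\longrightarrow}\mathrm{T}_\gamma\mathscr{P}_{\mathbf{p},\mathbf{q}}.$$ In either case, the isomorphism is defined by the formula $$(\mathrm{D}\eta)([f])=\frac{d}{dh}\Big\vert_{h=0}f(\gamma+h\eta).$$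
   Context: A diffeological space is a set $X$ together with, for each $n\in\mathbb{N}$ and each open $\widehat U\subseteq\mathbb{R}^n$, a specified set of functions $\widehat U\to X$, called plots, such that: (i) every constant function $\widehat U\to X$ is a plot; (ii) if $\widehat U\to X$ is a plot and $\widehat V\to\widehat U$ is a smooth map between open subsets of Euclidean spaces, then the composite $\widehat V\to X$ is a plot; (iii) if $\{\widehat U_i\}$ is an open cover of $\widehat U$ and $\widehat U\to X$ is a function each of whose restrictions $\widehat U_i\to X$ is a plot, then $\widehat U\to X$ is a plot. A function $X\to Y$ between diffeological spaces is smooth if its composite with every plot of $X$ is a plot of $Y$; $\mathrm{C}^\infty(X,Y)$ denotes the set of smooth functions. A smooth manifold $M$, with or without boundary (in particular $\mathbb{R}$, $\mathbb{R}^N$, $[a,b]$ and open subsets of Euclidean spaces), is regarded as a diffeological space whose plots are the maps $\widehat U\to M$ that are smooth in the usual sense. For such manifolds, diffeological smoothness of maps coincides with usual smoothness. A subset $U\subseteq X$ is D-open if $p^{-1}(U)$ is open for every plot $p$ of $X$. A subset $A\subseteq X$ is a diffeological subspace with plots the plots of $X$ with image in $A$. Plots of a product $X\times Y$ are the functions both of whose components are plots. The internal hom $[X,Y]$ is $\mathrm{C}^\infty(X,Y)$ with plots the functions $\widehat U\to\mathrm{C}^\infty(X,Y)$ whose adjoint $\widehat U\times X\to Y$ is smooth. Germs: for $x\in X$, $\mathrm{G}_xX:=\mathrm{colim}_{U\ni x}[U,\mathbb{R}]$, the colimit in diffeological spaces over D-open $U\ni x$ (with subspace diffeology) along restriction maps.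 Concretely, it is the set of pairs $(U,f)$, with $U$ a D-open neighbourhood of $x$ and $f\colon U\to\mathbb{R}$ smooth, modulo $(U,f)\sim(V,g)$ iff $f=g$ on some D-open neighbourhood of $x$ inside $U\cap V$; the class is written $[f]$. A function $p\colon\widehat U\to\mathrm{G}_xX$ is a plot iff each $\mathbf{u}\in\widehat U$ has an open neighbourhood $\widehat V\subseteq\widehat U$ such that $p|_{\widehat V}$ factors as $\widehat V\to[U,\mathbb{R}]\to\mathrm{G}_xX$ with $\widehat V\to[U,\mathbb{R}]$ a plot, for some D-open $U\ni x$. Germs form an $\mathbb{R}$-algebra under pointwise operations. Tangent space: a tangent vector on $X$ at $x$ is a map $v\colon\mathrm{G}_xX\to\mathbb{R}$ such that (i) $v$ is $\mathbb{R}$-linear; (ii) $v([f][g])=v([f])g(x)+f(x)v([g])$; (iii) $v$ is smooth as a map of diffeological spaces; (iv) (representability) $v$ is a linear combination $\lambda_1v_1+\cdots+\lambda_kv_k$ of derivations $v_i$ such that for each $i$ there are $\varepsilon_i>0$ and a plot $p_i\colon(-\varepsilon_i,\varepsilon_i)\to X$ with $p_i(0)=x$ and $v_i([f])=\frac{d}{dh}\big\vert_{h=0}f(p_i(h))$ for all $[f]$. $\mathrm{T}_xX$ is the real vector space of all tangent vectors at $x$, under pointwise operations. Path spaces: $\mathscr{P}:=[[a,b],\mathbb{R}^N]$, the internal hom; $\mathscr{P}_{\mathbf{p},\mathbf{q}}$ is the diffeological subspace of those $\gamma$ with $\gamma(a)=\mathbf{p}$, $\gamma(b)=\mathbf{q}$.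 $\mathscr{P}$ and $\mathscr{P}_{\mathbf{0},\mathbf{0}}$ (the case $\mathbf{p}=\mathbf{q}=\mathbf{0}$, the origin) are real vector spaces under pointwise addition and scalar multiplication. *)

(* Defs.v *)
From HB Require Import structures.
From mathcomp Require Import all_boot all_order all_algebra.
From mathcomp Require Import generic_quotient.
From mathcomp Require Import boolp classical_sets functions reals interval_inference.
From mathcomp Require Import topology normedtype landau derive.
From mathcomp Require Import ring.
Set Implicit Arguments.
Unset Strict Implicit.
Unset Printing Implicit Defensive.
Import Order.TTheory GRing.Theory Num.Theory.
Import numFieldNormedType.Exports.
Local Open Scope classical_set_scope.
Local Open Scope ring_scope.

Section Smooth.
Variable R : realType.

(* f is C^k at every point of the open set U; its values outside U play no
   role, since derivatives are local. *)
Fixpoint Ck (n : nat) (V : normedModType R) (k : nat)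
    (U : set 'rV[R]_n) (f : 'rV[R]_n -> V) : Prop :=
  if k is k'.+1 then
    (forall x, U x -> differentiable f x) /\ (forall v, Ck k' U ('D_v f))
  else forall x, U x -> {for x, continuous f}.

Definition smooth_on n (V : normedModType R) (U : set 'rV[R]_n)
  (f : 'rV[R]_n -> V) : Prop := forall k, Ck k U f.

Lemma near_open n (U : set 'rV[R]_n) (P : 'rV[R]_n -> Prop) x :
  open U -> U x -> (forall y, U y -> P y) -> \forall y \near x, P y.
Proof. by move=> oU Ux UP; apply: filterS UP _; apply: open_nbhs_nbhs. Qed.

Lemma near_eq_differentiable (V W : normedModType R) (f g : V -> W) (x : V) :
  (\forall y \near x, f y = g y) -> differentiable f x -> differentiable g x.
Proof.
move=> fg df.
suff d0 : differentiable (g - f) x.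
  have -> : g = f + (g - f) by rewrite addrC subrK.
  exact: differentiableD.
have fgx : f x = g x := nbhs_singleton fg.
have e0 : (g - f) \o shift x = cst ((g - f) x) + (\0 : V -> W) +o_ 0 id.
  apply/eqaddoP => _ /posnumP[e].
  move: fg; rewrite (near_shift 0) /= subr0 => fg; near=> h.
  change (`|(g (h + x) - f (h + x)) - ((g x - f x) + 0)| <= e%:num * `|h|).
  rewrite fgx subrr addr0 subr0.
  have -> : f (h + x) = g (h + x) by near: h.
  by rewrite subrr normr0 mulr_ge0.
have c0 : continuous (\0 : V -> W) by exact: cst_continuous.
apply/diff_locallyP.
by rewrite (diff_unique (df := (\0 : {linear V -> W})) c0 e0).
Unshelve. all: by end_near. Qed.

Section CkTheory.
Variables (n : nat).
Implicit Types (V : normedModType R) (U W : set 'rV[R]_n) (k : nat).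

Lemma Ck_eq V k U (f g : 'rV[R]_n -> V) : open U ->
  (forall x, U x -> f x = g x) -> Ck k U f -> Ck k U g.
Proof.
move=> oU; elim: k f g => [|k IH] f g fg /=.
  move=> cf x Ux; have nfg := near_open oU Ux fg.
  rewrite /prop_for /continuous_at -(fg _ Ux).
  exact: cvg_trans (near_eq_cvg nfg) (cf x Ux).
move=> [df Df]; split=> [x Ux|v].
  by apply: near_eq_differentiable (df x Ux); apply: near_open Ux fg.
apply: IH (Df v) => x Ux; apply: near_eq_derive.
exact: near_open Ux fg.
Qed.

Lemma Ck_local V k U (f : 'rV[R]_n -> V) :
  (forall x, U x -> exists2 W, W x & Ck k W f) -> Ck k U f.
Proof.
elim: k f => [|k IH] f loc /=.
  by move=> x /loc[W Wx]; apply.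
split=> [x /loc[W Wx [df _]]|v]; first exact: df.
by apply: IH => x /loc[W Wx [_ /(_ v) Df]]; exists W.
Qed.

Lemma Ck_sub V k U W (f : 'rV[R]_n -> V) : W `<=` U -> Ck k U f -> Ck k W f.
Proof. by move=> WU fU; apply: Ck_local => x Wx; exists U => //; exact: WU. Qed.

Lemma CkS V k U (f : 'rV[R]_n -> V) : Ck k.+1 U f -> Ck k U f.
Proof.
elim: k f => [|k IH] f /= [df Df].
  by move=> x Ux; apply: differentiable_continuous; exact: df.
by split=> // v; apply: IH; exact: Df.
Qed.

Lemma Ck_cst V k U (c : V) : Ck k U (cst c).
Proof.
elim: k c => [|k IH] c /=; first by move=> x _; exact: cst_continuous.
split=> [x _|v]; first exact: differentiable_cst.
have -> : 'D_v (cst c) = cst 0 :> ('rV[R]_n -> V).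
  by apply/funext => x; rewrite derive_cst.
exact: IH.
Qed.

Lemma CkD V k U (f g : 'rV[R]_n -> V) : open U ->
  Ck k U f -> Ck k U g -> Ck k U (f + g).
Proof.
move=> oU; elim: k f g => [|k IH] f g /=.
  by move=> cf cg x Ux; apply: continuousD; [exact: cf|exact: cg].
move=> [df Df] [dg Dg]; split=> [x Ux|v].
  by apply: differentiableD; [exact: df|exact: dg].
apply: (Ck_eq oU _ (IH _ _ (Df v) (Dg v))) => x Ux; apply/esym/deriveD;
  apply: diff_derivable; [exact: df|exact: dg].
Qed.

Lemma Ck_sum V k U m (f : 'I_m -> 'rV[R]_n -> V) : open U ->
  (forall i, Ck k U (f i)) -> Ck k U (\sum_i f i).
Proof.
move=> oU Cf; elim/big_ind: _ => //; first exact: Ck_cst.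
by move=> *; apply: CkD.
Qed.

Lemma differentiable_scale V (a : 'rV[R]_n -> R) (f : 'rV[R]_n -> V) x :
  differentiable a x -> differentiable f x ->
  is_diff x (fun y => a y *: f y) (fun h => a x *: 'd f x h + 'd a x h *: f x).
Proof.
move=> da df.
have bil : bilinear_for
    (GRing.Scale.Law.clone _ _ *:%R _) (GRing.Scale.Law.clone _ _ *:%R _)
    (@GRing.scale R V).
  split=> [u c x' y'|u c x' y'] /=; first by rewrite scalerDl scalerA.
  by rewrite scalerDr !scalerA mulrC.
pose Bm := bilinear_isBilinear.Build R R V V _ _ (@GRing.scale R V) bil.
pose B : {bilinear R -> V -> V} := HB.pack (@GRing.scale R V) Bm.
have Bc : continuous (fun p : R * V => B p.1 p.2) by exact: scale_continuous.
have dp : differentiable (fun y => (a y, f y)) x by exact: differentiable_pair.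
have dB := differentiable_bilin (f := B) (a x, f x) Bc.
apply: DiffDef; first exact: (differentiable_comp dp dB).
transitivity ('d (fun p : R * V => B p.1 p.2) (a x, f x) \o
  'd (fun y => (a y, f y)) x); first exact: (diff_comp dp dB).
by rewrite (diff_bilin (a x, f x) Bc) diff_pair.
Qed.

Lemma Ck_scale V k U (a : 'rV[R]_n -> R) (f : 'rV[R]_n -> V) : open U ->
  Ck k U a -> Ck k U f -> Ck k U (fun x => a x *: f x).
Proof.
move=> oU; elim: k a f => [|k IH] a f.
  move=> ca cf x Ux.
  exact: (cvgZ (ca x Ux) (cf x Ux)).
move=> Sa Sf; have [da Da] := Sa; have [df Df] := Sf.
split=> [x Ux|v].
  by case: (differentiable_scale (da x Ux) (df x Ux)).
have IH1 := IH _ _ (CkS Sa) (Df v); have IH2 := IH _ _ (Da v) (CkS Sf).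
apply: (Ck_eq oU _ (CkD oU IH1 IH2)) => x Ux.
have [dd ddE] := differentiable_scale (da x Ux) (df x Ux).
rewrite (deriveE v dd) ddE.
by rewrite -(deriveE v (da x Ux)) -(deriveE v (df x Ux)).
Qed.

Lemma CkZ V k U (c : R) (f : 'rV[R]_n -> V) : open U ->
  Ck k U f -> Ck k U (c *: f).
Proof. by move=> oU; apply: Ck_scale => //; exact: Ck_cst. Qed.

Lemma Ck_coord k U i (f : 'rV[R]_n -> 'rV[R]_i) (j : 'I_i) : open U ->
  Ck k U f -> Ck k U (fun x => f x 0 j).
Proof.
move=> oU; elim: k f => [|k IH] f /=.
  move=> cf x Ux.
  exact: (cvg_comp _ _ (cf x Ux) (@coord_continuous _ _ _ 0 j (f x))).
move=> [df Df]; split=> [x Ux|v].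
  exact: (differentiable_comp (df x Ux) (@differentiable_coord _ _ _ (f x) 0 j)).
apply: (Ck_eq oU _ (IH _ (Df v))) => x Ux.
rewrite derive_mx; last exact/diff_derivable/df.
by rewrite mxE.
Qed.

End CkTheory.

Lemma Ck_comp m n (V : normedModType R) k (W : set 'rV[R]_m) (U : set 'rV[R]_n)
    (h : 'rV[R]_m -> 'rV[R]_n) (f : 'rV[R]_n -> V) : open W ->
  (forall x, W x -> U (h x)) -> Ck k W h -> Ck k U f -> Ck k W (f \o h).
Proof.
move=> oW; elim: k V f => [|k IH] V f WU.
  by move=> ch cf x Wx; exact: (cvg_comp _ _ (ch x Wx) (cf _ (WU x Wx))).
move=> Sh [df Df]; have [dh Dh] := Sh; split=> [x Wx|v].
  exact: (differentiable_comp (dh x Wx) (df _ (WU x Wx))).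
pose g j := fun x => ('D_v h x) 0 j *: ('D_(delta_mx 0 j) f \o h) x.
have Cg j : Ck k W (g j).
  apply: Ck_scale => //; first exact: (Ck_coord j oW (Dh v)).
  exact: (IH _ _ WU (CkS Sh) (Df _)).
apply: (Ck_eq oW _ (Ck_sum oW Cg)) => x Wx.
have dhx := dh x Wx; have dfx := df _ (WU x Wx).
rewrite fct_sumE deriveE; last exact: differentiable_comp.
rewrite diff_comp // /= -(deriveE v dhx) [in RHS](row_sum_delta ('D_v h x)).
rewrite linear_sum; apply: eq_bigr => j _.
by rewrite linearZ /g /= (deriveE (delta_mx 0 j) dfx).
Qed.

End Smooth.

(* ['valL_v f] extends f : A -> T by the value v outside of A. *)
#[global] Arguments valL_ {U V} v {A} f u : simpl never.

Section SmoothOnOpens.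
Variable R : realType.

(* Smoothness of a function defined on the subtype U only, U being open; the
   choice of the extension is immaterial, see [smoothP]. *)
Definition smooth n (V : normedModType R) (U : set 'rV[R]_n) (f : U -> V) :=
  smooth_on U ('valL_0 f).

Lemma valLE (S T : Type) (A : set S) (v : T) (f : A -> T) (u : A) :
  'valL_v f (val u) = f u.
Proof. exact: (congr1 (@^~ u) (valLK v f)). Qed.

Lemma set_typeP (T : Type) (A : set T) x : A x -> exists u : A, val u = x.
Proof. by move=> Ax; exists (SigSub (mem_set Ax)). Qed.

Lemma smoothP n (V : normedModType R) (U : set 'rV[R]_n) (f : U -> V) g :
  open U -> (forall u : U, g (val u) = f u) -> smooth_on U g <-> smooth f.
Proof.
move=> oU gf.
have gE x : U x -> g x = 'valL_0 f x.
  by move=> Ux; have [u <-] := set_typeP Ux; rewrite valLE gf.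
split=> S k; apply: (Ck_eq oU _ (S k)) => x Ux; rewrite gE //.
Qed.

Lemma smooth_cst n (V : normedModType R) (U : set 'rV[R]_n) (c : V) :
  open U -> smooth (fun _ : U => c).
Proof.
by move=> oU; apply: (smoothP (g := cst c) oU _).1 => // k; exact: Ck_cst.
Qed.

Lemma smooth_val n (U W : set 'rV[R]_n) (WU : W `<=` U) : open W ->
  smooth (fun w : W => val (subfun WU w)).
Proof.
move=> oW; apply: (smoothP (g := id) oW _).1 => // k.
case: k => [|k] /=; first by move=> x _; exact: cvg_id.
split=> [x _|v]; first exact: ex_diff.
apply: (Ck_eq oW _ (@Ck_cst _ _ _ _ _ v)) => x _.
by rewrite derive_id.
Qed.

Lemma smooth_comp m n (V : normedModType R) (W : set 'rV[R]_m)
    (U : set 'rV[R]_n) (h : W -> U) (f : U -> V) : open W ->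
  smooth (fun w => val (h w)) -> smooth f -> smooth (f \o h).
Proof.
move=> oW Sh Sf.
apply: (smoothP (g := 'valL_0 f \o 'valL_0 (fun w => val (h w))) oW _).1.
  by move=> w /=; rewrite !valLE.
move=> k; apply: (Ck_comp oW) (Sf k) => //.
by move=> x Wx; have [w <-] := set_typeP Wx; rewrite valLE; apply: set_valP.
Qed.

Lemma smooth_local n (V : normedModType R) (U : set 'rV[R]_n) (f : U -> V) :
  open U -> (forall u : U, exists W (WU : W `<=` U),
    [/\ open W, W (val u) & smooth (f \o subfun WU)]) -> smooth f.
Proof.
move=> oU loc k; apply: Ck_local => x Ux; have [u <-] := set_typeP Ux.
have [W [WU [oW Wu Sf]]] := loc u; exists W => //.
apply: (Ck_eq oW _ (Sf k)) => y Wy; have [w <-] := set_typeP Wy; rewrite valLE /=.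
by rewrite -(valLE 0 f).
Qed.

Lemma smoothD n (V : normedModType R) (U : set 'rV[R]_n) (f g : U -> V) :
  open U -> smooth f -> smooth g -> smooth (fun u => f u + g u).
Proof.
move=> oU Sf Sg.
apply: (smoothP (g := 'valL_0 f + 'valL_0 g) oU _).1.
  by move=> u; rewrite -(valLE 0 f) -(valLE 0 g).
by move=> k; apply: CkD.
Qed.

Lemma smoothZ n (V : normedModType R) (U : set 'rV[R]_n) (f : U -> R)
  (g : U -> V) : open U -> smooth f -> smooth g ->
  smooth (fun u => f u *: g u).
Proof.
move=> oU Sf Sg.
apply: (smoothP (g := fun x => 'valL_0 f x *: 'valL_0 g x) oU _).1.
  by move=> u; rewrite !valLE.
by move=> k; apply: Ck_scale.
Qed.

Lemma smooth_open_preimage m n (W : set 'rV[R]_m) (U : set 'rV[R]_n)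
    (h : W -> U) (B : set 'rV[R]_n) : open W ->
  smooth (fun w => val (h w)) -> open B ->
  open (val @` ((fun w => val (h w)) @^-1` B)).
Proof.
move=> oW /(_ 0%N) /= ch oB.
rewrite openE => x [w /= Bhw wx].
have Wx : W x by rewrite -wx; exact: set_valP.
have nW : \forall y \near x, W y by apply: open_nbhs_nbhs; split.
have nB : \forall y \near x, B ('valL_0 (fun w => val (h w)) y).
  apply: (ch x Wx); apply: open_nbhs_nbhs; split=> //.
  by rewrite -wx valLE.
rewrite /interior; near=> y.
have [u uy] : exists u : W, val u = y by apply: set_typeP; near: y.
exists u => //=.
rewrite -(valLE 0 (fun w => val (h w))) uy; near: y; exact: nB.
Unshelve. all: by end_near. Qed.

End SmoothOnOpens.

(* [plot] is a predicate on functions from arbitrary subsets of R^n, which by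
   [plot_open] can hold only on open ones. *)
Record diffeology (R : realType) := Diffeology {
  points :> Type;
  plot : forall (n : nat) (U : set 'rV[R]_n), (U -> points) -> Prop;
  plot_open : forall (n : nat) (U : set 'rV[R]_n) (p : U -> points),
    plot p -> open U;
  plot_cst : forall (n : nat) (U : set 'rV[R]_n) (x : points),
    open U -> plot (fun _ : U => x);
  plot_comp : forall (m n : nat) (W : set 'rV[R]_m) (U : set 'rV[R]_n)
    (h : W -> U) (p : U -> points),
    open W -> smooth (fun w => val (h w)) -> plot p -> plot (p \o h);
  plot_cover : forall (n : nat) (U : set 'rV[R]_n) (I : Type)
    (W : I -> set 'rV[R]_n) (WU : forall i, W i `<=` U) (p : U -> points),
    open U -> (forall i, open (W i)) -> U `<=` \bigcup_i W i ->
    (forall i, plot (p \o subfun (WU i))) -> plot p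
}.

Section Diffeology.
Variable R : realType.
Implicit Types X Y : diffeology R.

Definition dsmooth X Y (f : X -> Y) : Prop :=
  forall (n : nat) (U : set 'rV[R]_n) (p : U -> X), plot p -> plot (f \o p).

(* The preimage of A under p : U -> X, seen as a subset of R^n. *)
Definition D_open X (A : set X) : Prop :=
  forall (n : nat) (U : set 'rV[R]_n) (p : U -> X), plot p ->
    open (val @` (p @^-1` A)).

(* Used at V = R and V = 'rV_N. *)
Section Euclid.
Variable V : normedModType R.

Definition Euclid_plot n (U : set 'rV[R]_n) (p : U -> V) : Prop :=
  open U /\ smooth p.

Fact Euclid_plot_open n (U : set 'rV[R]_n) (p : U -> V) :
  Euclid_plot p -> open U.
Proof. by case. Qed.

Fact Euclid_plot_cst n (U : set 'rV[R]_n) (x : V) :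
  open U -> Euclid_plot (fun _ : U => x).
Proof. by move=> oU; split=> //; exact: smooth_cst. Qed.

Fact Euclid_plot_comp m n (W : set 'rV[R]_m) (U : set 'rV[R]_n)
  (h : W -> U) (p : U -> V) :
  open W -> smooth (fun w => val (h w)) -> Euclid_plot p ->
  Euclid_plot (p \o h).
Proof. by move=> oW Sh [oU Sp]; split=> //; exact: smooth_comp. Qed.

Fact Euclid_plot_cover n (U : set 'rV[R]_n) (I : Type)
    (W : I -> set 'rV[R]_n) (WU : forall i, W i `<=` U) (p : U -> V) :
  open U -> (forall i, open (W i)) -> U `<=` \bigcup_i W i ->
  (forall i, Euclid_plot (p \o subfun (WU i))) -> Euclid_plot p.
Proof.
move=> oU oW cov Sp; split=> //; apply: smooth_local => // u.
have [i _ Wiu] := cov _ (set_valP u); exists (W i), (WU i); split=> //.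
by case: (Sp i).
Qed.

Definition Euclid : diffeology R :=
  Diffeology Euclid_plot_open Euclid_plot_cst Euclid_plot_comp
    Euclid_plot_cover.
End Euclid.

Section Subspace.
Variables (X : diffeology R) (A : set X).

Definition dsub_plot n (U : set 'rV[R]_n) (p : U -> A) : Prop :=
  plot (fun u => val (p u)).

Fact dsub_plot_open n (U : set 'rV[R]_n) (p : U -> A) :
  dsub_plot p -> open U.
Proof. exact: plot_open. Qed.

Fact dsub_plot_cst n (U : set 'rV[R]_n) (x : A) :
  open U -> dsub_plot (fun _ : U => x).
Proof. exact: plot_cst. Qed.

Fact dsub_plot_comp m n (W : set 'rV[R]_m) (U : set 'rV[R]_n)
  (h : W -> U) (p : U -> A) :
  open W -> smooth (fun w => val (h w)) -> dsub_plot p ->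
  dsub_plot (p \o h).
Proof. by move=> oW Sh Sp; exact: plot_comp Sp. Qed.

Fact dsub_plot_cover n (U : set 'rV[R]_n) (I : Type)
    (W : I -> set 'rV[R]_n) (WU : forall i, W i `<=` U) (p : U -> A) :
  open U -> (forall i, open (W i)) -> U `<=` \bigcup_i W i ->
  (forall i, dsub_plot (p \o subfun (WU i))) -> dsub_plot p.
Proof. by move=> oU oW cov Sp; exact: plot_cover Sp. Qed.

Definition dsub : diffeology R :=
  Diffeology dsub_plot_open dsub_plot_cst dsub_plot_comp dsub_plot_cover.
End Subspace.

Section Product.
Variables X Y : diffeology R.

Definition dprod_plot n (U : set 'rV[R]_n) (p : U -> X * Y) : Prop :=
  plot (fun u => (p u).1) /\ plot (fun u => (p u).2).

Fact dprod_plot_open n (U : set 'rV[R]_n) (p : U -> X * Y) :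
  dprod_plot p -> open U.
Proof. by case=> /plot_open. Qed.

Fact dprod_plot_cst n (U : set 'rV[R]_n) (x : X * Y) :
  open U -> dprod_plot (fun _ : U => x).
Proof. by move=> oU; split; exact: plot_cst. Qed.

Fact dprod_plot_comp m n (W : set 'rV[R]_m) (U : set 'rV[R]_n)
  (h : W -> U) (p : U -> X * Y) :
  open W -> smooth (fun w => val (h w)) -> dprod_plot p ->
  dprod_plot (p \o h).
Proof.
move=> oW Sh [p1 p2]; split; [exact: plot_comp p1|exact: plot_comp p2].
Qed.

Fact dprod_plot_cover n (U : set 'rV[R]_n) (I : Type)
    (W : I -> set 'rV[R]_n) (WU : forall i, W i `<=` U) (p : U -> X * Y) :
  open U -> (forall i, open (W i)) -> U `<=` \bigcup_i W i ->
  (forall i, dprod_plot (p \o subfun (WU i))) -> dprod_plot p.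
Proof.
move=> oU oW cov Sp; split.
  by apply: (plot_cover (WU := WU)) => // i; have [] := Sp i.
by apply: (plot_cover (WU := WU)) => // i; have [] := Sp i.
Qed.

Definition dprod : diffeology R :=
  Diffeology dprod_plot_open dprod_plot_cst dprod_plot_comp dprod_plot_cover.
End Product.

Definition dsmooth_pred X Y : {pred X -> Y} := fun f => `[< dsmooth f >].

Record dmap X Y := DMap {
  dmap_fun :> X -> Y;
  dmapP : dmap_fun \in @dsmooth_pred X Y
}.

Section Hom.
Variables X Y : diffeology R.

Definition dhom_plot n (U : set 'rV[R]_n) (p : U -> dmap X Y) : Prop :=
  open U /\
  @dsmooth (dprod (dsub (X := Euclid 'rV[R]_n) U) X) Y
    (fun ux => p ux.1 ux.2).

Fact dhom_plot_open n (U : set 'rV[R]_n) (p : U -> dmap X Y) :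
  dhom_plot p -> open U.
Proof. by case. Qed.

Fact dhom_plot_cst n (U : set 'rV[R]_n) (f : dmap X Y) :
  open U -> dhom_plot (fun _ : U => f).
Proof.
move=> oU; split=> // m W q [_ q2].
by have /asboolP := dmapP f; apply.
Qed.

Fact dhom_plot_comp m n (W : set 'rV[R]_m) (U : set 'rV[R]_n)
  (h : W -> U) (p : U -> dmap X Y) :
  open W -> smooth (fun w => val (h w)) -> dhom_plot p ->
  dhom_plot (p \o h).
Proof.
move=> oW Sh [oU Sp]; split=> // k Z q [q1 q2].
apply: (Sp _ _ (fun z => (h (q z).1, (q z).2))); split=> //=.
have [oZ Sq1] := q1; split=> //.
exact: (smooth_comp (f := fun w => val (h w)) oZ Sq1 Sh).
Qed.

Fact dhom_plot_cover n (U : set 'rV[R]_n) (I : Type)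
    (W : I -> set 'rV[R]_n) (WU : forall i, W i `<=` U) (p : U -> dmap X Y) :
  open U -> (forall i, open (W i)) -> U `<=` \bigcup_i W i ->
  (forall i, dhom_plot (p \o subfun (WU i))) -> dhom_plot p.
Proof.
move=> oU oW cov Sp; split=> // m Z q [q1 q2].
have [oZ Sq1] := q1.
pose Z' i := val @` ((fun z => val (q z).1) @^-1` W i).
have Z'Z i : Z' i `<=` Z by move=> _ [z _ <-]; exact: set_valP.
have oZ' i : open (Z' i) by exact: smooth_open_preimage Sq1 (oW i).
apply: (plot_cover (WU := Z'Z)) => //.
  move=> z' Zz'; have [z <-] := set_typeP Zz'; have [i _ Wi] := cov _ (set_valP (q z).1).
  by exists i => //; exists z.
move=> i; have [_ Spi] := Sp i.
have Wq (z : Z' i) : W i (val (q (subfun (Z'Z i) z)).1).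
  have [z' Wz' zz'] := set_valP z.
  by have -> : subfun (Z'Z i) z = z' by apply: val_inj.
pose q' (z : Z' i) : set_type (W i) * X :=
  (SigSub (mem_set (Wq z)), (q (subfun (Z'Z i) z)).2).
have Sq' : @plot _ (dprod (dsub (X := Euclid 'rV[R]_n) (W i)) X) _ _ q'.
  split=> /=; last exact: (plot_comp _ (smooth_val (Z'Z i) _) q2).
  exact: (plot_comp _ (smooth_val (Z'Z i) _) q1).
have := Spi _ _ _ Sq'; congr plot; apply/funext => z /=.
by congr (p _ _); apply: val_inj.
Qed.

Definition dhom : diffeology R :=
  Diffeology dhom_plot_open dhom_plot_cst dhom_plot_comp dhom_plot_cover.
End Hom.

End Diffeology.

Local Open Scope quotient_scope.

Section Germs.
Variables (R : realType) (X : diffeology R) (x : X).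

Record pregerm := Pregerm {
  pdom : set X;
  pdom_open : D_open pdom;
  pdomx : pdom x;
  pfun : dmap (dsub pdom) (Euclid R)
}.

HB.instance Definition _ := gen_eqMixin pregerm.
HB.instance Definition _ := gen_choiceMixin pregerm.

(* Extended by 0 outside of the domain, which is invisible near x. *)
Definition pval (f : pregerm) : X -> R := 'valL_(0 : R) (pfun f).

Definition germ_equiv (f g : pregerm) : bool :=
  `[< exists A : set X, [/\ D_open A, A x, A `<=` pdom f `&` pdom g &
       forall y, A y -> pval f y = pval g y] >].

Lemma D_openI (A B : set X) : D_open A -> D_open B -> D_open (A `&` B).
Proof.
move=> oA oB n U p Sp.
have -> : val @` (p @^-1` (A `&` B)) =
    (val @` (p @^-1` A)) `&` (val @` (p @^-1` B)).
  apply/seteqP; split=> [_ [u [Au Bu] <-]|z [[u Au <-] [v Bv /val_inj vu]]].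
    by split; exists u.
  by exists u => //; split=> //=; rewrite -vu.
by apply: openI; [exact: oA|exact: oB].
Qed.

Lemma D_openT : D_open [set: X].
Proof.
move=> n U p Sp; have -> : val @` (p @^-1` [set: X]) = U; last exact: plot_open Sp.
apply/seteqP; split=> [_ [u _ <-]|z Uz]; first exact: set_valP.
by have [u <-] := set_typeP Uz; exists u.
Qed.

Fact germ_equiv_equiv : equiv_class_of germ_equiv.
Proof.
split=> [f|f g|g f h].
- by apply/asboolP; exists (pdom f); split=> //; [exact: pdom_open|exact: pdomx].
- apply/asboolP/asboolP => -[A [oA Ax AI fg]]; exists A; split=> //;
  by [rewrite setIC|move=> y Ay; rewrite fg].
- move=> /asboolP[A [oA Ax AI fg]] /asboolP[B [oB Bx BI gh]].
  apply/asboolP; exists (A `&` B); split; [exact: D_openI|by []| |].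
    by move=> y [/AI[fy _] /BI[_ hy]].
  by move=> y [Ay By]; rewrite fg // gh.
Qed.
Canonical germ_equiv_rel := EquivRelPack germ_equiv_equiv.

Definition germ := {eq_quot germ_equiv}.
HB.instance Definition _ : EqQuotient pregerm germ_equiv germ :=
  EqQuotient.on germ.
HB.instance Definition _ := Choice.on germ.

Definition germ_of (f : pregerm) : germ := \pi_germ f.

Lemma germ_eq (f g : pregerm) (A : set X) : D_open A -> A x ->
  A `<=` pdom f `&` pdom g -> (forall y, A y -> pval f y = pval g y) ->
  germ_of f = germ_of g.
Proof. by move=> oA Ax AI fg; apply/eqmodP/asboolP; exists A. Qed.

Section Restriction.
Variables (A : set X) (f : X -> R).
Hypotheses (oA : D_open A) (Ax : A x).
Hypothesis Sf : @dsmooth _ (dsub A) (Euclid R) (fun y => f (val y)).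

Definition mk_pregerm : pregerm :=
  Pregerm oA Ax (@DMap _ (dsub A) (Euclid R) (fun y => f (val y)) (asboolT Sf)).

Lemma mk_pregermE y : A y -> pval mk_pregerm y = f y.
Proof. by move=> Ay; have [u <-] := set_typeP Ay; rewrite /pval valLE. Qed.
End Restriction.

Lemma dsmooth_pval (f : pregerm) (A : set X) : A `<=` pdom f ->
  @dsmooth _ (dsub A) (Euclid R) (fun y => pval f (val y)).
Proof.
move=> Af n U p Sp.
have /asboolP Sf := dmapP (pfun f).
have := Sf n U (subfun Af \o p) Sp; congr plot; apply/funext => u /=.
exact/esym/(valLE 0 (pfun f) (subfun Af (p u))).
Qed.

Fact pg_add_smooth (f g : pregerm) :
  @dsmooth _ (dsub (pdom f `&` pdom g)) (Euclid R)
    (fun y => pval f (val y) + pval g (val y)).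
Proof.
move=> n U p Sp; have oU := plot_open Sp; split=> //.
have [_ S1] := dsmooth_pval (@subIsetl _ (pdom f) (pdom g)) Sp.
have [_ S2] := dsmooth_pval (@subIsetr _ (pdom f) (pdom g)) Sp.
exact: (smoothD oU S1 S2).
Qed.

Fact pg_scale_smooth (c : R) (f : pregerm) :
  @dsmooth _ (dsub (pdom f)) (Euclid R) (fun y => c * pval f (val y)).
Proof.
move=> n U p Sp; have oU := plot_open Sp; split=> //.
have [_ S1] := dsmooth_pval (@subset_refl _ (pdom f)) Sp.
exact: (smoothZ oU (smooth_cst c oU) S1).
Qed.

Fact pg_mul_smooth (f g : pregerm) :
  @dsmooth _ (dsub (pdom f `&` pdom g)) (Euclid R)
    (fun y => pval f (val y) * pval g (val y)).
Proof.
move=> n U p Sp; have oU := plot_open Sp; split=> //.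
have [_ S1] := dsmooth_pval (@subIsetl _ (pdom f) (pdom g)) Sp.
have [_ S2] := dsmooth_pval (@subIsetr _ (pdom f) (pdom g)) Sp.
exact: (smoothZ oU S1 S2).
Qed.

Fact pg_cst_smooth (c : R) :
  @dsmooth _ (dsub [set: X]) (Euclid R) (fun _ => c).
Proof. by move=> n U p Sp; exact/plot_cst/plot_open/Sp. Qed.

Definition pg_cst (c : R) : pregerm :=
  mk_pregerm (f := fun _ => c) D_openT I (@pg_cst_smooth c).

Definition pg_add (f g : pregerm) : pregerm :=
  mk_pregerm (f := fun y => pval f y + pval g y)
    (D_openI (@pdom_open f) (@pdom_open g)) (conj (pdomx f) (pdomx g))
    (@pg_add_smooth f g).

Definition pg_scale (c : R) (f : pregerm) : pregerm :=
  mk_pregerm (f := fun y => c * pval f y) (@pdom_open f) (pdomx f)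
    (@pg_scale_smooth c f).

Definition pg_mul (f g : pregerm) : pregerm :=
  mk_pregerm (f := fun y => pval f y * pval g y)
    (D_openI (@pdom_open f) (@pdom_open g)) (conj (pdomx f) (pdomx g))
    (@pg_mul_smooth f g).

Definition germ_cst (c : R) : germ := germ_of (pg_cst c).
Definition germ_add (F G : germ) : germ := germ_of (pg_add (repr F) (repr G)).
Definition germ_scale (c : R) (F : germ) : germ := germ_of (pg_scale c (repr F)).
Definition germ_mul (F G : germ) : germ := germ_of (pg_mul (repr F) (repr G)).
Definition germ_eval (F : germ) : R := pval (repr F) x.

Lemma repr_pi (f : pregerm) : exists A : set X, [/\ D_open A, A x,
  A `<=` pdom (repr (germ_of f)) `&` pdom f &
  forall y, A y -> pval (repr (germ_of f)) y = pval f y].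
Proof. apply/asboolP; suff /eqmodP : repr (germ_of f) = f %[mod germ] by [].
by rewrite reprK. Qed.

Lemma germ_add_pi f g : germ_add (germ_of f) (germ_of g) = germ_of (pg_add f g).
Proof.
have [A [oA Ax AI fE]] := repr_pi f; have [B [oB Bx BI gE]] := repr_pi g.
apply: (germ_eq (A := A `&` B)); [exact: D_openI|by []| |].
  by move=> y [/AI[? ?] /BI[? ?]].
by move=> y [Ay By]; have [? ?] := AI _ Ay; have [? ?] := BI _ By;
  rewrite !mk_pregermE // fE // gE.
Qed.

Lemma germ_mul_pi f g : germ_mul (germ_of f) (germ_of g) = germ_of (pg_mul f g).
Proof.
have [A [oA Ax AI fE]] := repr_pi f; have [B [oB Bx BI gE]] := repr_pi g.
apply: (germ_eq (A := A `&` B)); [exact: D_openI|by []| |].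
  by move=> y [/AI[? ?] /BI[? ?]].
by move=> y [Ay By]; have [? ?] := AI _ Ay; have [? ?] := BI _ By;
  rewrite !mk_pregermE // fE // gE.
Qed.

Lemma germ_scale_pi c f : germ_scale c (germ_of f) = germ_of (pg_scale c f).
Proof.
have [A [oA Ax AI fE]] := repr_pi f; apply: (germ_eq (A := A)) => //.
by move=> y Ay; have [? ?] := AI _ Ay; rewrite !mk_pregermE // fE.
Qed.

Lemma germ_eval_pi f : germ_eval (germ_of f) = pval f x.
Proof. by have [A [oA Ax AI fE]] := repr_pi f; exact: fE. Qed.

Let germ_ext (f g : pregerm) :
  (forall y, pdom f y -> pdom g y -> pval f y = pval g y) ->
  germ_of f = germ_of g.
Proof.
move=> fg; apply: (germ_eq (A := pdom f `&` pdom g)) => //.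
- by apply: D_openI; exact: pdom_open.
- by split; exact: pdomx.
- by move=> y [fy gy]; exact: fg.
Qed.

Let pg_cstE c y : pval (pg_cst c) y = c.
Proof. by rewrite mk_pregermE. Qed.
Let pg_addE f g y : pdom f y -> pdom g y ->
  pval (pg_add f g) y = pval f y + pval g y.
Proof. by move=> fy gy; rewrite mk_pregermE. Qed.
Let pg_mulE f g y : pdom f y -> pdom g y ->
  pval (pg_mul f g) y = pval f y * pval g y.
Proof. by move=> fy gy; rewrite mk_pregermE. Qed.
Let pg_scaleE c f y : pdom f y -> pval (pg_scale c f) y = c * pval f y.
Proof. by move=> fy; rewrite mk_pregermE. Qed.

Let germP (P : germ -> Prop) : (forall f, P (germ_of f)) -> forall F, P F.
Proof. by move=> Pf F; rewrite -[F]reprK; exact: Pf. Qed.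

Fact germ_addA : associative germ_add.
Proof.
elim/germP=> f; elim/germP=> g; elim/germP=> h; rewrite !germ_add_pi.
apply: germ_ext => y [fy [gy hy]] _.
by rewrite !pg_addE ?addrA //; split.
Qed.

Fact germ_addC : commutative germ_add.
Proof.
elim/germP=> f; elim/germP=> g; rewrite !germ_add_pi.
by apply: germ_ext => y [fy gy] _; rewrite !pg_addE // addrC.
Qed.

Fact germ_add0 : left_id (germ_cst 0) germ_add.
Proof.
elim/germP=> f; rewrite germ_add_pi.
by apply: germ_ext => y [? fy] _; rewrite !pg_addE // pg_cstE add0r.
Qed.

Fact germ_addN : left_inverse (germ_cst 0) (germ_scale (-1)) germ_add.
Proof.
elim/germP=> f; rewrite germ_scale_pi germ_add_pi.
apply: germ_ext => y [? fy] _.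
by rewrite !pg_addE // pg_scaleE // pg_cstE mulN1r addNr.
Qed.

HB.instance Definition _ :=
  GRing.isZmodule.Build germ germ_addA germ_addC germ_add0 germ_addN.

Fact germ_mulA : associative germ_mul.
Proof.
elim/germP=> f; elim/germP=> g; elim/germP=> h; rewrite !germ_mul_pi.
apply: germ_ext => y [fy [gy hy]] _.
by rewrite !pg_mulE ?mulrA //; split.
Qed.

Fact germ_mulC : commutative germ_mul.
Proof.
elim/germP=> f; elim/germP=> g; rewrite !germ_mul_pi.
by apply: germ_ext => y [fy gy] _; rewrite !pg_mulE // mulrC.
Qed.

Fact germ_mul1 : left_id (germ_cst 1) germ_mul.
Proof.
elim/germP=> f; rewrite germ_mul_pi.
by apply: germ_ext => y [? fy] _; rewrite !pg_mulE // pg_cstE mul1r.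
Qed.

Fact germ_mulDl : left_distributive germ_mul germ_add.
Proof.
elim/germP=> f; elim/germP=> g; elim/germP=> h.
rewrite germ_add_pi !germ_mul_pi germ_add_pi.
apply: germ_ext => y [[fy gy] hy] _.
by rewrite pg_addE ?pg_mulE ?pg_addE // mulrDl.
Qed.

Fact germ_1_neq0 : germ_cst 1 != germ_cst 0.
Proof.
apply/eqP => /(congr1 germ_eval); rewrite !germ_eval_pi !pg_cstE.
exact/eqP/oner_neq0.
Qed.

HB.instance Definition _ := GRing.Zmodule_isComNzRing.Build germ
  germ_mulA germ_mulC germ_mul1 germ_mulDl germ_1_neq0.

Fact germ_scaleA c d F : germ_scale c (germ_scale d F) = germ_scale (c * d) F.
Proof.
elim/germP: F => f; rewrite !germ_scale_pi; apply: germ_ext => y fy _.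
by rewrite !pg_scaleE // mulrA.
Qed.

Fact germ_scale1 : left_id 1 germ_scale.
Proof.
elim/germP=> f; rewrite !germ_scale_pi; apply: germ_ext => y fy _.
by rewrite !pg_scaleE // mul1r.
Qed.

Fact germ_scaleDr : right_distributive germ_scale germ_add.
Proof.
move=> c; elim/germP=> f; elim/germP=> g.
rewrite germ_add_pi !germ_scale_pi germ_add_pi.
apply: germ_ext => y [fy gy] _.
by rewrite pg_addE ?pg_scaleE ?pg_addE // mulrDr.
Qed.

Fact germ_scaleDl F : {morph germ_scale^~ F : c d / c + d >-> germ_add c d}.
Proof.
move=> c d; elim/germP: F => f.
rewrite !germ_scale_pi germ_add_pi.
apply: germ_ext => y fy _.
by rewrite pg_addE ?pg_scaleE // mulrDl.
Qed.

HB.instance Definition _ := GRing.Zmodule_isLmodule.Build R germ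
  germ_scaleA germ_scale1 germ_scaleDr germ_scaleDl.

Fact germ_scaleAl c (F G : germ) : 
  germ_scale c (germ_mul F G) = germ_mul (germ_scale c F) G.
Proof.
elim/germP: F => f; elim/germP: G => g.
rewrite germ_mul_pi !germ_scale_pi germ_mul_pi.
apply: germ_ext => y [fy gy] _.
by rewrite pg_scaleE ?pg_mulE ?pg_scaleE // mulrA.
Qed.

HB.instance Definition _ := GRing.Lmodule_isLalgebra.Build R germ germ_scaleAl.
HB.instance Definition _ := GRing.Lalgebra_isComAlgebra.Build R germ.

(* The colimit diffeology: locally, plots lift to some [U, R]. *)
Definition germ_plot n (U : set 'rV[R]_n) (p : U -> germ) : Prop :=
  open U /\ forall u : U, exists (W : set 'rV[R]_n) (WU : W `<=` U)
    (A : set X) (oA : D_open A) (Ax : A x)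
    (q : W -> dhom (dsub A) (Euclid R)),
    [/\ open W, W (val u), plot q &
        forall w, p (subfun WU w) = germ_of (Pregerm oA Ax (q w))].

Fact germ_plot_open n (U : set 'rV[R]_n) (p : U -> germ) :
  germ_plot p -> open U.
Proof. by case. Qed.

Fact germ_plot_cst n (U : set 'rV[R]_n) (F : germ) :
  open U -> germ_plot (fun _ : U => F).
Proof.
move=> oU; split=> // u; elim/germP: F => -[A oA Ax f].
exists U, (@subset_refl _ U), A, oA, Ax, (fun _ => f); split=> //.
- exact: set_valP.
- exact: plot_cst.
Qed.

Fact germ_plot_comp m n (W : set 'rV[R]_m) (U : set 'rV[R]_n)
  (h : W -> U) (p : U -> germ) :
  open W -> smooth (fun w => val (h w)) -> germ_plot p -> germ_plot (p \o h).
Proof.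
move=> oW Sh [oU Gp]; split=> // w.
have [U' [U'U [A [oA [Ax [q [oU' U'w Sq pq]]]]]]] := Gp (h w).
pose W' := val @` ((fun w => val (h w)) @^-1` U').
have W'W : W' `<=` W by move=> _ [z _ <-]; exact: set_valP.
have oW' : open W' by exact: smooth_open_preimage Sh oU'.
have W'h (z : W') : U' (val (h (subfun W'W z))).
  have [z' Uz' zz'] := set_valP z.
  by have -> : subfun W'W z = z' by apply: val_inj.
pose h' (z : W') : U' := SigSub (mem_set (W'h z)).
exists W', W'W, A, oA, Ax, (q \o h'); split=> //.
- by exists w.
- apply: plot_comp Sq => //.
  exact: (smooth_comp (f := fun w => val (h w)) oW' (smooth_val W'W oW') Sh).
- by move=> z /=; rewrite -pq; congr p; apply: val_inj.
Qed.

Fact germ_plot_cover n (U : set 'rV[R]_n) (I : Type)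
    (W : I -> set 'rV[R]_n) (WU : forall i, W i `<=` U) (p : U -> germ) :
  open U -> (forall i, open (W i)) -> U `<=` \bigcup_i W i ->
  (forall i, germ_plot (p \o subfun (WU i))) -> germ_plot p.
Proof.
move=> oU oW cov Gp; split=> // u; have [i _ Wiu] := cov _ (set_valP u).
have [_ /(_ (SigSub (mem_set Wiu)))] := Gp i.
move=> [Z [ZW [A [oA [Ax [q [oZ Zu Sq pq]]]]]]].
exists Z, (subset_trans ZW (WU i)), A, oA, Ax, q; split=> // z.
by rewrite -pq /=; congr p; apply: val_inj.
Qed.

Definition germ_space : diffeology R :=
  Diffeology germ_plot_open germ_plot_cst germ_plot_comp germ_plot_cover.

End Germs.

Section Tangent.
Variables (R : realType) (X : diffeology R) (x : X).
Implicit Types v w : germ x -> R.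

Definition derivation v : Prop :=
  scalar v /\
  forall F G, v (F * G) = v F * germ_eval G + germ_eval F * v G.

(* The interval (-e, e) as a subset of R^1. *)
Definition sym_itv (e : R) : set 'rV[R]_1 := [set t | - e < t 0 0 < e].

(* v [f] = d/dh f (p h) at h = 0 for some plot p : (-e, e) -> X through x; p is
   extended by x outside of (-e, e). *)
Definition velocity v : Prop :=
  exists (e : R) (p : sym_itv e -> X),
    [/\ 0 < e, plot p, (forall t, val t = 0 -> p t = x) &
        forall f : pregerm x,
          is_derive (0 : R) (1 : R)
            (fun h => pval f ('valL_x p (const_mx h))) (v (germ_of f))].

Definition representable v : Prop :=
  exists (k : nat) (c : 'I_k -> R) (w : 'I_k -> germ x -> R),
    (forall i, derivation (w i) /\ velocity (w i)) /\
    (forall F, v F = \sum_i c i * w i F).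

Definition tangent_vector v : Prop :=
  [/\ derivation v, @dsmooth _ (germ_space x) (Euclid R) v & representable v].

Definition tangent_pred : {pred germ x -> R} := fun v => `[< tangent_vector v >].

Record tangent := Tangent {
  tfun :> germ x -> R;
  tangentP : tfun \in tangent_pred
}.

HB.instance Definition _ := [isSub for tfun].
HB.instance Definition _ := [Choice of tangent by <:].

Fact tangent_submod_closed : submod_closed tangent_pred.
Proof.
split=> [|c v w].
  apply/asboolP; split.
  - split=> [a F G|F G]; first by change (0 = a * 0 + 0 :> R); ring.
    by change (0 = 0 * germ_eval G + germ_eval F * 0 :> R); ring.
  - by move=> n U p Sp; exact/plot_cst/plot_open/Sp.
  - by exists 0%N, (fun=> 0), (fun=> 0); split=> [[]|F] //; rewrite big_ord0.
move=> /asboolP[[vl vM] Sv [k1 [c1 [v1 [v1P vE]]]]].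
move=> /asboolP[[wl wM] Sw [k2 [c2 [v2 [v2P wE]]]]].
apply/asboolP; split.
- split=> [a F G|F G].
    change (c * v (a *: F + G) + w (a *: F + G) =
      a * (c * v F + w F) + (c * v G + w G)); rewrite vl wl; ring.
  change (c * v (F * G) + w (F * G) =
    (c * v F + w F) * germ_eval G + germ_eval F * (c * v G + w G)).
  by rewrite vM wM; ring.
- move=> n U p Sp; have oU := plot_open Sp; split=> //.
  have [_ S1] := Sv _ _ _ Sp; have [_ S2] := Sw _ _ _ Sp.
  exact: (smoothD oU (smoothZ oU (smooth_cst c oU) S1) S2).
- exists (k1 + k2)%N.
  exists (fun i => match fintype.split i with inl j => c * c1 j | inr j => c2 j end).
  exists (fun i => match fintype.split i with inl j => v1 j | inr j => v2 j end).
  split=> [i|F]; first by case: (fintype.split i).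
  change (c * v F + w F = \sum_i match fintype.split i with
    inl j => c * c1 j | inr j => c2 j end *
    (match fintype.split i with inl j => v1 j | inr j => v2 j end) F).
  rewrite vE wE big_split_ord /= mulr_sumr.
  congr (_ + _); apply: eq_bigr => j _.
    by rewrite (unsplitK (inl j : 'I_k1 + 'I_k2)) mulrA.
  by rewrite (unsplitK (inr j : 'I_k1 + 'I_k2)).
Qed.

HB.instance Definition _ :=
  GRing.isSubmodClosed.Build R (germ x -> R) tangent_pred tangent_submod_closed.
HB.instance Definition _ := [SubChoice_isSubLmodule of tangent by <:].
End Tangent.

(* C^oo(X, V) is a vector space under the pointwise operations. *)
Section SmoothFunctions.
Variables (R : realType) (X : diffeology R) (V : normedModType R).

HB.instance Definition _ := [isSub for @dmap_fun R X (Euclid V)].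
HB.instance Definition _ := [Choice of dmap X (Euclid V) by <:].

Fact dsmooth_submod_closed : submod_closed (@dsmooth_pred R X (Euclid V) : {pred X -> V}).
Proof.
split=> [|c f g].
  by apply/asboolP => n U p Sp; exact/plot_cst/plot_open/Sp.
move=> /asboolP Sf /asboolP Sg; apply/asboolP => n U p Sp.
have oU := plot_open Sp; split=> //.
have [_ S1] := Sf _ _ _ Sp; have [_ S2] := Sg _ _ _ Sp.
exact: (smoothD oU (smoothZ oU (smooth_cst c oU) S1) S2).
Qed.

HB.instance Definition _ :=
  GRing.isSubmodClosed.Build R (X -> V) (@dsmooth_pred R X (Euclid V)) dsmooth_submod_closed.
HB.instance Definition _ := [SubChoice_isSubLmodule of dmap X (Euclid V) by <:].
End SmoothFunctions.

Section Paths.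
Variables (R : realType) (N : nat) (a b : R).

Definition segment : diffeology R := dsub (X := Euclid R) `[a, b]%classic.
Definition path_space : diffeology R := dhom segment (Euclid 'rV[R]_N).

(* The carrier of [path_space], seen as a real vector space. *)
Definition paths : Type := path_space.
HB.instance Definition _ :=
  GRing.Lmodule.copy paths (dmap segment (Euclid 'rV[R]_N)).

Hypothesis ab : a < b.

Fact left_end_subproof : a \in `[a, b]%classic.
Proof. by rewrite inE /= in_itv /= lexx ltW. Qed.
Fact right_end_subproof : b \in `[a, b]%classic.
Proof. by rewrite inE /= in_itv /= lexx ltW. Qed.
Definition left_end : segment := SigSub left_end_subproof.
Definition right_end : segment := SigSub right_end_subproof.

Definition fixed_ends (p q : 'rV[R]_N) : set paths :=
  [set g : dmap segment (Euclid 'rV[R]_N) |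
    g left_end = p /\ g right_end = q].

Definition fixed_path_space (p q : 'rV[R]_N) : diffeology R :=
  dsub (X := path_space) (fixed_ends p q).

Definition loops0_pred : {pred paths} := fun g => g \in fixed_ends 0 0.

Fact loops0_submod_closed : submod_closed loops0_pred.
Proof.
split=> [|c f g]; rewrite !unfold_in /loops0_pred !inE; first by split.
by move=> [fa fb] [ga gb]; split;
  [change (c *: (f : dmap _ _) left_end + (g : dmap _ _) left_end = 0)
  |change (c *: (f : dmap _ _) right_end + (g : dmap _ _) right_end = 0)];
  rewrite ?fa ?fb ?ga ?gb scaler0 addr0.
Qed.

HB.instance Definition _ :=
  GRing.isSubmodClosed.Build R paths loops0_pred loops0_submod_closed.

(* The carrier of [fixed_path_space 0 0], seen as a real vector space. *)
Definition loops0 : Type := fixed_path_space 0 0.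
Fact loops0_rect (K : loops0 -> Type)
  (KS : forall g (g0 : g \in fixed_ends 0 0), K (SigSub g0)) u : K u.
Proof. by case: u => g g0; exact: KS. Qed.
HB.instance Definition _ := @isSub.Build paths loops0_pred loops0
  sval (fun g g0 => SigSub g0) loops0_rect (fun _ _ => erefl).
HB.instance Definition _ := [Choice of loops0 by <:].
HB.instance Definition _ := [SubChoice_isSubLmodule of loops0 by <:].

Definition line (g eta : paths) (h : R) : path_space := g + h *: eta.

Fact line_fixed_ends p q (g : fixed_path_space p q) (eta : loops0) (h : R) :
  line (val g) (val eta) h \in fixed_ends p q.
Proof.
have [ga gb] := set_valP g; have [ea eb] := set_valP eta.
rewrite inE; split.
  change ((sval g : dmap _ _) left_end + h *: (sval eta : dmap _ _) left_end = p).
  by rewrite ga ea scaler0 addr0.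
change ((sval g : dmap _ _) right_end + h *: (sval eta : dmap _ _) right_end = q).
by rewrite gb eb scaler0 addr0.
Qed.

Definition fixed_line p q (g : fixed_path_space p q) (eta : loops0) (h : R) :
  fixed_path_space p q := SigSub (line_fixed_ends g eta h).

End Paths.

(* Main.v *)
From HB Require Import structures.
Require Import Defs.
From mathcomp Require Import all_boot all_order all_algebra.
From mathcomp Require Import boolp classical_sets functions reals ereal.
From mathcomp Require Import topology normedtype landau derive realfun.
From mathcomp Require Import measure lebesgue_measure lebesgue_integral ftc.
From mathcomp Require Import ring lra.
Import Order.TTheory GRing.Theory Num.Theory.
Import numFieldNormedType.Exports.
Local Open Scope classical_set_scope.
Local Open Scope ring_scope.
Set Implicit Arguments.
Unset Strict Implicit.

(** A curve c through x, that is, a one-dimensional plot with c 0 = x, defines the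
derivation [vel c] : [f] |-> d/dh f (c h) at h = 0.  It is a tangent vector: a
plot of germs is locally w |-> [f_w] with f_w (y) jointly smooth, so that
(h, w) |-> f_w (c h) is smooth on an open set of a Euclidean space, and so is its
partial derivative in h ([vel_smooth], [vel_tangent]).

If P is a plot of dimension n with P 0 = x, then f o P is differentiable at 0,
whence d/dh f (P (h v)) is linear in v ([vel_plot]).  Apply this to the plots
(y, z) |-> g + y eta_1 + z eta_2 to see that eta |-> D eta is linear.  It is
injective because the coordinates of eta t are values of D eta on the germs
of the smooth functions gamma |-> gamma t.

Surjectivity rests on the division lemma of Hadamard: a curve c through g can
be written as c h = g + h s(h) with s again a smooth curve of paths.  Then
P (y, z) = g + y s(z) is a plot of dimension two and c h = P (h, h), so that
d/dh f (c h) is the sum of the two partial derivatives of f o P at 0.  Since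
P (0, z) = g is constant, only the first one remains; it is the derivative of
f (g + h s(0)), and therefore vel c = D (s 0).  By representability every tangent
vector is a linear combination of such derivations.

Hadamard's lemma holds in path spaces because smoothness there is tested on
the finitely many variables (h, z) of c h (t z), for plots t of the interval:
the quotient (G (h, z) - G (0, z)) / h of a smooth function G is the integral over
s in [0, 1] of its first partial derivative at (s h, z) ([smooth_quotient]), and
an integral over a compact interval depends smoothly on parameters
([Ck_param_int]).

The two statements are treated at once: [linear_chart] lists what is used of a
parametrization of X by a vector space E (the addition and scaling of E are
smooth, smooth functionals separate the vectors, Hadamard's lemma holds),
[linear_chart_iso] deduces the isomorphism, and [translation_chart] shows that
eta |-> g + eta is such a parametrization for paths subject to prescribed values
at the points of any set of parameters, in particular none or both endpoints. *)

(** * Smooth maps between coordinate spaces *)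

Section SmoothCalculus.
Variable R : realType.

Lemma Ck_coordinate m k (U : set 'rV[R]_m) (j : 'I_m) :
  open U -> Ck k U (fun x : 'rV[R]_m => x 0 j).
Proof.
move=> oU; case: k => [|k] /=.
  by move=> x _; exact: coord_continuous.
split=> [x _|v]; first exact: differentiable_coord.
apply: (Ck_eq oU _ (@Ck_cst _ _ _ _ _ (v 0 j))) => x _.
have := derive_mx (@derivable_id _ _ x v); rewrite derive_id.
by move=> /(congr1 (fun M : 'rV[R]_m => M 0 j)); rewrite mxE.
Qed.

Lemma Ck_row m n k (U : set 'rV[R]_m) (f : 'rV[R]_m -> 'rV[R]_n) :
  open U -> (forall j, Ck k U (fun x => f x 0 j)) -> Ck k U f.
Proof.
move=> oU Cf.
have Cg j : Ck k U (fun x => f x 0 j *: delta_mx 0 j : 'rV[R]_n).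
  by apply: Ck_scale => //; exact: Ck_cst.
apply: (Ck_eq oU _ (Ck_sum oU Cg)) => x Ux.
by rewrite fct_sumE -row_sum_delta.
Qed.

Lemma is_derive_line (V W : normedModType R) (f : V -> W) (x v : V) (t : R) :
  differentiable f (x + t *: v) ->
  is_derive t (1 : R) (fun s : R => f (x + s *: v)) ('D_v f (x + t *: v)).
Proof.
move=> df; have dv := diff_derivable (v := v) df.
have E : (fun h : R => h^-1 *: (((fun s : R => f (x + s *: v)) \o shift t) (h *: (1 : R))
     - f (x + t *: v))) =
   (fun h : R => h^-1 *: ((f \o shift (x + t *: v)) (h *: v) - f (x + t *: v))).
  apply/funext => h /=; congr (_ *: (f _ - _)).
  by rewrite [h *: 1]mulr1 scalerDl addrCA.
by split; rewrite /derivable /derive E.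
Qed.

Lemma is_derive_line0 (V : normedModType R) n (f : 'rV[R]_n -> V) (v : 'rV[R]_n) :
  differentiable f 0 -> is_derive (0 : R) (1 : R) (fun h : R => f (h *: v)) ('D_v f 0).
Proof.
move=> df; have E : (fun h : R => f (h *: v)) = (fun h : R => f (0 + h *: v)).
  by apply/funext => h; rewrite add0r.
have := @is_derive_line _ _ f 0 v 0; rewrite -E scale0r addr0; exact.
Qed.

(** The point (s, x); the first coordinate is the one along which one
integrates, differentiates or divides. *)
Definition consv (s : R) n (x : 'rV[R]_n) : 'rV[R]_(1 + n) :=
  row_mx (const_mx s) x.

Lemma consvE s n (x : 'rV[R]_n) : lsubmx (consv s x) 0 0 = s.
Proof. by rewrite row_mxKl mxE. Qed.

Lemma consv_eta n (z : 'rV[R]_(1 + n)) : z = consv (lsubmx z 0 0) (rsubmx z).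
Proof.
rewrite -[LHS]hsubmxK; congr row_mx; apply/matrixP => i j.
by rewrite !mxE !ord1 lshift0.
Qed.

Lemma consvD s t n (x y : 'rV[R]_n) : consv (s + t) (x + y) = consv s x + consv t y.
Proof. by rewrite /consv add_row_mx; congr row_mx; apply/matrixP=> i j; rewrite !mxE. Qed.

Lemma consvZ c s n (x : 'rV[R]_n) : consv (c * s) (c *: x) = c *: consv s x.
Proof. by rewrite /consv scale_row_mx; congr row_mx; apply/matrixP=> i j; rewrite !mxE. Qed.

Lemma Ck_consv m n k (U : set 'rV[R]_m) (f : 'rV[R]_m -> R)
  (g : 'rV[R]_m -> 'rV[R]_n) :
  open U -> Ck k U f -> Ck k U g -> Ck k U (fun x => consv (f x) (g x)).
Proof.
move=> oU Cf Cg; apply: Ck_row => // j; case: (split_ordP j) => i ->.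
  by apply: (Ck_eq oU _ Cf) => x _; rewrite row_mxEl mxE.
by apply: (Ck_eq oU _ (Ck_coord i oU Cg)) => x _; rewrite row_mxEr.
Qed.

Lemma Ck_lsub n k (U : set 'rV[R]_(1 + n)) :
  open U -> Ck k U (fun z => lsubmx z 0 0).
Proof.
move=> oU; apply: (Ck_eq oU _ (Ck_coordinate k (lshift n 0) oU)) => x _.
by rewrite mxE.
Qed.

Lemma Ck_rsub n k (U : set 'rV[R]_(1 + n)) :
  open U -> Ck k U (fun z => rsubmx z : 'rV[R]_n).
Proof.
move=> oU; apply: Ck_row => // j.
apply: (Ck_eq oU _ (Ck_coordinate k (rshift 1 j) oU)) => x _.
by rewrite mxE.
Qed.

Lemma Ck_id n k (U : set 'rV[R]_n) : open U -> Ck k U id.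
Proof. by move=> oU; apply: Ck_row => // j; exact: Ck_coordinate. Qed.

Lemma consv_cvg n (s : R) (x : 'rV[R]_n) :
  (fun p : R * 'rV[R]_n => consv p.1 p.2) @ (s, x) --> consv s x.
Proof.
have E : (fun p : R * 'rV[R]_n => consv p.1 p.2) =
    (fun p => p.1 *: consv 1 (0 : 'rV[R]_n)) + (fun p => consv 0 p.2).
  apply/funext => p.
  change (consv p.1 p.2 = p.1 *: consv 1 (0 : 'rV[R]_n) + consv 0 p.2).
  by rewrite -consvZ -consvD scaler0 mulr1 addr0 add0r.
have c2 : continuous (fun y : 'rV[R]_n => consv 0 y).
  move=> y; have oT := @openT 'rV[R]_n.
  have := @Ck_consv n n 0 setT (cst 0) id oT (@Ck_cst _ _ _ _ _ _) (Ck_id 0 oT).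
  exact.
have : (fun p : R * 'rV[R]_n => p.1 *: consv 1 (0 : 'rV[R]_n)) + (fun p => consv 0 p.2)
   @ (s, x) --> s *: consv 1 (0 : 'rV[R]_n) + consv 0 x.
  apply: cvgD; first by apply: cvgZr_tmp; exact: cvg_fst.
  apply: (cvg_comp (fun p : R * 'rV[R]_n => p.2) (fun y => consv 0 y)); first exact: cvg_snd.
  exact: c2.
by rewrite -E -consvZ -consvD scaler0 mulr1 addr0 add0r.
Qed.

Lemma open_slab n (r : R) (W : set 'rV[R]_n) : open W ->
  open [set z : 'rV[R]_(1 + n) | - r < lsubmx z 0 0 < r /\ W (rsubmx z)].
Proof.
move=> oW; have oT := @openT 'rV[R]_(1 + n).
rewrite (_ : [set _ | _] = ((fun z => lsubmx z 0 0) @^-1` [set` `]- r, r[]) `&`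
    ((fun z => rsubmx z) @^-1` W)); last first.
  by apply/seteqP; split=> z; rewrite /= in_itv.
apply: openI; apply: open_comp => //.
- by move=> z _; exact: (Ck_lsub 0 oT).
- by move=> z _; exact: (Ck_rsub 0 oT).
Qed.

Lemma derive_consv1 (V : normedModType R) n
    (G : 'rV[R]_(1 + n) -> V) (u : 'rV[R]_n) :
  'D_(consv 1 0) G (consv 0 u) = 'D_1 (fun h : R => G (consv h u)) 0.
Proof.
have E : (fun h : R => h^-1 *: ((G \o shift (consv 0 u)) (h *: consv 1 0) - G (consv 0 u))) =
    (fun h : R => h^-1 *: (((fun s : R => G (consv s u)) \o shift 0) (h *: 1) - G (consv 0 u))).
  by apply/funext => h /=; rewrite -consvZ -consvD scaler0 add0r.
by rewrite /derive E.
Qed.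

End SmoothCalculus.

(** * Integrals depending on parameters *)

Section ParametricIntegral.
Variables (R : realType) (n : nat).
Implicit Types (K : 'rV[R]_(1 + n) -> R) (x y : 'rV[R]_n).

Definition continuous_over K x :=
  forall s, `[0, 1]%classic s -> {for consv s x, continuous K}.

(** Uniformity in s comes from compactness of [0, 1]. *)
Lemma near_over K x (e : R) : continuous_over K x -> 0 < e ->
  \forall y \near x, forall s, `[0, 1]%classic s -> `|K (consv s y) - K (consv s x)| <= e.
Proof.
move=> cK e0.
have /compact_near_coveringP cov := @segment_compact R 0 1.
apply: (cov _ (nbhs x) (fun y s => `|K (consv s y) - K (consv s x)| <= e)) => s s01.
have e2 : 0 < e / 2 by rewrite divr_gt0.
have cKs := cvg_comp _ _ (@consv_cvg R n s x) (cK s s01).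
have /cvgrPdist_le /(_ _ e2) [[A B] /= [nA nB] AB] := cKs.
exists (A, B) => //= -[t y] /= [At By].
have Ky := AB (t, y) (conj At By).
have Kx := AB (t, x) (conj At (nbhs_singleton nB)).
rewrite /= in Ky Kx.
rewrite (_ : _ - _ =
  (K (consv s x) - K (consv t x)) - (K (consv s x) - K (consv t y))); last by ring.
apply: (le_trans (ler_normB _ _)); lra.
Qed.

Local Notation mu := (@lebesgue_measure R).

Lemma consv_cvg_l x (s : R) : (fun t : R => consv t x) @ s --> consv s x.
Proof.
have sx : (fun t : R => (t, x)) @ s --> (s, x).
  exact: (cvg_pair cvg_id (cvg_cst x)).
exact: (cvg_comp _ _ sx (@consv_cvg R n s x)).
Qed.

Lemma integrable_over K x : continuous_over K x ->
  mu.-integrable `[0, 1]%classic (EFin \o (fun s => K (consv s x))).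
Proof.
move=> cK; apply: continuous_compact_integrable; first exact: segment_compact.
apply: continuous_in_subspaceT => s; rewrite inE => s01.
exact: (cvg_comp _ _ (@consv_cvg_l x s) (cK s s01)).
Qed.

Lemma integral01_cst (c : R) : \int[mu]_(_ in `[0, 1]) c = c.
Proof.
rewrite Rintegral_cst //= lebesgue_measure_itv /= lte_fin ltr01.
by rewrite oppr0 adde0 mulr1.
Qed.

Lemma normr_integral01 (f : R -> R) (e : R) :
  mu.-integrable `[0, 1]%classic (EFin \o f) ->
  (forall s, `[0, 1]%classic s -> `|f s| <= e) ->
  `|\int[mu]_(s in `[0, 1]) f s| <= e.
Proof.
move=> If fe; apply: (le_trans (le_normr_Rintegral _ If)) => //.
rewrite -[leRHS]integral01_cst.
apply: le_Rintegral => //; first exact: (@integrable_norm _ _ _ mu).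
apply: continuous_compact_integrable; first exact: segment_compact.
by apply: continuous_subspaceT => ?; exact: cvg_cst.
Qed.

Definition param_int K x := \int[mu]_(s in `[0, 1]) K (consv s x).

Lemma continuous_param_int K x : continuous_over K x ->
  (\forall y \near x, continuous_over K y) -> {for x, continuous (param_int K)}.
Proof.
move=> cK cKn; apply/(@cvgrPdist_le _ _ _ (nbhs x)) => e e0.
apply: (@filterS2 _ (nbhs x) _ _ _ _ _ cKn (near_over cK e0)) => y cKy Ky.
rewrite distrC /param_int -RintegralB //; [|exact: integrable_over..].
apply: normr_integral01 => //.
apply: (@integrableB _ _ _ mu _ _ (EFin \o (fun s => K (consv s y)))
  (EFin \o (fun s => K (consv s x)))) => //; exact: integrable_over.
Qed.

(** Automatic in finite dimension: a linear form is a combination of coordinates. *)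
Lemma linear_rV_continuous (f : {linear 'rV[R]_n -> R}) : continuous f.
Proof.
have Cf : Ck 0 setT (\sum_j (fun x : 'rV[R]_n => x 0 j *: f (delta_mx 0 j))).
  apply: Ck_sum => [|j]; first exact: openT.
  by apply: Ck_scale; [exact: openT|exact/Ck_coordinate/openT|exact: Ck_cst].
move=> x; suff -> : (f : _ -> _) = \sum_j (fun x : 'rV[R]_n => x 0 j *: f (delta_mx 0 j)).
  exact: Cf.
apply/funext => y; rewrite fct_sumE {1}[y]row_sum_delta linear_sum.
by apply: eq_bigr => j _; rewrite linearZ.
Qed.

Lemma derive_consv_sum K x (v : 'rV[R]_n) s : differentiable K (consv s x) ->
  'D_(consv 0 v) K (consv s x) =
  \sum_j v 0 j * 'D_(consv 0 (delta_mx 0 j)) K (consv s x).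
Proof.
move=> dK; rewrite deriveE // {1}[v]row_sum_delta.
have -> : consv 0 (\sum_j v 0 j *: delta_mx 0 j) =
    \sum_j v 0 j *: consv (0 : R) (delta_mx 0 j : 'rV[R]_n).
  elim/big_ind2: _ => [|y y' z z' <- <-|j _].
  - by apply/rowP => i; case: (split_ordP i) => k ->;
      rewrite ?row_mxEl ?row_mxEr !mxE.
  - by rewrite -consvD addr0.
  - by rewrite -consvZ mulr0.
rewrite linear_sum; apply: eq_bigr => j _.
by rewrite linearZ /= deriveE.
Qed.

Lemma normr_coord_le x (j : 'I_n) : `|x 0 j| <= `|x|.
Proof.
rewrite {2}/Num.norm /= mx_normrE.
exact: (le_bigmax _ (fun i : 'I_1 * 'I_n => `|x i.1 i.2|) (0, j)).
Qed.

Definition C1_over K x :=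
  (forall s, `[0, 1]%classic s -> differentiable K (consv s x)) /\
  (forall v, continuous_over ('D_v K) x).

Lemma C1_over_continuous K x : C1_over K x -> continuous_over K x.
Proof. by move=> [dK _] s s01; exact/differentiable_continuous/dK. Qed.

Lemma is_diff_bound (V W : normedModType R) (f : V -> W) (L : {linear V -> W})
    (x : V) : continuous L ->
  (forall e : R, 0 < e -> \forall v \near (0 : V), `|f (v + x) - (f x + L v)| <= e * `|v|) ->
  is_diff x f L.
Proof.
move=> cL fL.
have e0 : f \o shift x = cst (f x) + (L : V -> W) +o_ 0 id by apply/eqaddoP => e /fL.
have LD := diff_unique cL e0.
apply: DiffDef; last by rewrite LD.
by apply/diff_locallyP; rewrite LD.
Qed.

(** Differentiation under the integral sign, in the total sense. The mean value
theorem turns the increment of K at (s, x) into the derivative at a nearby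
point (s, x + t v), and by [near_over] the partial derivatives at the two points
differ little, uniformly in s; so the error is small after integration as well. *)
Lemma is_diff_param_int K x : (\forall y \near x, C1_over K y) ->
  is_diff x (param_int K) (fun v => param_int ('D_(consv 0 v) K) x).
Proof.
move=> nC1; have [dKx DKx] := nbhs_singleton nC1.
have lin : linear (fun v => param_int ('D_(consv 0 v) K) x).
  move=> c v w; rewrite /param_int.
  have I1 := integrable_over (DKx (consv 0 v)).
  have I2 := integrable_over (DKx (consv 0 w)).
  have I3 : mu.-integrable `[0, 1]%classic
      (EFin \o (fun s => c * 'D_(consv 0 v) K (consv s x))).
    exact: (@integrableZl _ _ _ mu _ _ c (EFin \o (fun s => 'D_(consv 0 v) K (consv s x)))).
  have -> (r t : R) : c *: r + t = c * r + t by [].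
  rewrite -RintegralZl // -RintegralD //.
  apply: eq_Rintegral => s; rewrite inE => s01.
  have dK := dKx s s01; rewrite !deriveE //.
  rewrite -[c * _]linearZ -linearD -consvZ -consvD mulr0 addr0 //.
pose Lm := GRing.isLinear.Build R 'rV[R]_n R *:%R _ lin.
pose L : {linear 'rV[R]_n -> R} := HB.pack (fun v => param_int ('D_(consv 0 v) K) x) Lm.
apply: (is_diff_bound (f := param_int K) (L := L)); first exact: linear_rV_continuous.
move=> e e0.
(* The increment in direction v is a sum of n partial derivatives, each to be
   controlled up to e'; n.+1 avoids a division by 0. *)
pose e' := e / n.+1%:R.
have e'0 : 0 < e' by rewrite divr_gt0.
have nD : \forall y \near x, forall j s, `[0, 1]%classic s ->
    `|'D_(consv 0 (delta_mx 0 j)) K (consv s y) -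
      'D_(consv 0 (delta_mx 0 j)) K (consv s x)| <= e'.
  apply: (@filter_forall _ _ (fun (j : 'I_n) y => forall s,
    `[0, 1]%classic s -> `|_ - _| <= e') (nbhs x)) => j.
  exact: (near_over (DKx _) e'0).
have [r /= r0 rP] := (@nbhs_ballP _ _ x _).1 (@filterI _ (nbhs x) _ _ _ nC1 nD).
apply/nbhs_ballP; exists r => //= v; rewrite -ball_normE /= sub0r normrN => vr.
change (`|param_int K (v + x) - (param_int K x + param_int ('D_(consv 0 v) K) x)|
  <= e * `|v|).
have seg (t : R) : `[0, 1]%classic t -> ball x r (x + t *: v).
  rewrite /= in_itv /= => /andP[t0 t1]; rewrite -ball_normE /= opprD addNKr normrN.
  rewrite normrZ ger0_norm //; apply: le_lt_trans vr.
  by rewrite ler_piMl.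
have C1t (t : R) (t01 : `[0, 1]%classic t) := (rP _ (seg t t01)).1.
have Dt (t : R) (t01 : `[0, 1]%classic t) := (rP _ (seg t t01)).2.
have cv : continuous_over K (v + x).
  apply: C1_over_continuous; rewrite addrC -[v]scale1r; apply: C1t.
  by rewrite /= in_itv /= ler01 lexx.
have cx := C1_over_continuous (nbhs_singleton nC1).
rewrite opprD addrA /param_int -RintegralB //; [|exact: integrable_over..].
have Ivx : mu.-integrable `[0, 1]%classic
   (EFin \o (fun s => K (consv s (v + x)) - K (consv s x))).
  apply: (@integrableB _ _ _ mu _ _ (EFin \o (fun s => K (consv s (v + x))))
    (EFin \o (fun s => K (consv s x)))) => //; exact: integrable_over.
have ID := integrable_over (DKx (consv 0 v)).
rewrite -RintegralB //.
apply: normr_integral01 => [|s s01].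
  exact: (@integrableB _ _ _ mu _ _
    (EFin \o (fun s => K (consv s (v + x)) - K (consv s x)))
    (EFin \o (fun s => 'D_(consv 0 v) K (consv s x)))).
have line_E t : consv s (x + t *: v) = consv s x + t *: consv 0 v.
  by rewrite -consvZ -consvD mulr0 addr0.
have dline (t : R) : `[0, 1]%classic t ->
    is_derive t (1 : R) (fun t : R => K (consv s x + t *: consv 0 v))
      ('D_(consv 0 v) K (consv s x + t *: consv 0 v)).
  move=> t01; apply: is_derive_line; rewrite -line_E; exact: (C1t t t01).1.
pose F (t : R) := K (consv s x + t *: consv 0 v).
pose dF (t : R) := 'D_(consv 0 v) K (consv s x + t *: consv 0 v).
have derF (t : R) : t \in `]0, 1[%R -> is_derive t 1 F (dF t).
  move=> t01; apply: dline; exact: subset_itv_oo_cc.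
have cF : {within `[0, 1], continuous F}.
  apply: continuous_in_subspaceT => t; rewrite inE => t01.
  apply: differentiable_continuous; apply/derivable1_diffP.
  by case: (dline t t01).
have [t t01 FE] := MVT_segment ler01 derF cF.
have -> : K (consv s (v + x)) - K (consv s x) = 'D_(consv 0 v) K (consv s (x + t *: v)).
  by move: FE; rewrite /F /dF -!line_E scale0r addr0 scale1r subr0 mulr1 [v + x]addrC.
rewrite !derive_consv_sum //; [|exact: dKx|exact: (C1t t t01).1].
rewrite -sumrB; apply: (le_trans (ler_norm_sum _ _ _)).
apply: (@le_trans _ _ (\sum_(j < n) `|v| * e')).
  apply: ler_sum => j _; rewrite -mulrBr normrM; apply: ler_pM => //.
    exact: normr_coord_le.
  exact: Dt.
rewrite sumr_const card_ord -mulr_natr -mulrA mulrC ler_wpM2r //.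
by rewrite /e' mulrAC ler_pdivrMr // ler_wpM2l ?ler_nat // ltW.
Qed.

End ParametricIntegral.

(** * Hadamard's lemma *)

Section Hadamard.
Variable R : realType.
Local Notation mu := (@lebesgue_measure R).

Lemma Ck_continuous n (V : normedModType R) k (U : set 'rV[R]_n)
    (f : 'rV[R]_n -> V) : Ck k U f -> forall x, U x -> {for x, continuous f}.
Proof. by elim: k => [//|k IH] /CkS. Qed.

(** The derivative in direction v of the integral of K is the integral of the
derivative of K in direction (0, v): the statement reproduces itself, whence
an induction on k. *)
Lemma Ck_param_int n k (W : set 'rV[R]_(1 + n)) (U : set 'rV[R]_n)
    (K : 'rV[R]_(1 + n) -> R) :
  open U -> (forall s x, `[0, 1]%classic s -> U x -> W (consv s x)) ->
  Ck k W K -> Ck k U (param_int K).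
Proof.
move=> oU UW; elim: k K => [|k IH] K CK /=.
  move=> x Ux; apply: continuous_param_int => [s s01|].
    exact: (CK _ (UW _ _ s01 Ux)).
  by apply: near_open oU Ux _ => y Uy s s01; exact: (CK _ (UW _ _ s01 Uy)).
have [dK DK] := CK.
have dI x : U x -> is_diff x (param_int K) (fun v => param_int ('D_(consv 0 v) K) x).
  move=> Ux; apply: is_diff_param_int; apply: near_open oU Ux _ => y Uy.
  split=> [s s01|v s s01]; first exact: (dK _ (UW _ _ s01 Uy)).
  exact: (Ck_continuous (DK v) (UW _ _ s01 Uy)).
split=> [x /dI[]//|v].
apply: (Ck_eq oU _ (IH _ (DK (consv 0 v)))) => x Ux.
by have [dIx DIx] := dI x Ux; rewrite deriveE // DIx.
Qed.

(** The difference quotient of G in its first variable, continued to the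
hyperplane where this variable vanishes. *)
Definition quotient n (V : normedModType R) (G : 'rV[R]_(1 + n) -> V)
    (z : 'rV[R]_(1 + n)) : V :=
  let h := lsubmx z 0 0 in
  if h == 0 then 'D_(consv 1 0) G z else h^-1 *: (G z - G (consv 0 (rsubmx z))).

(** The function s |-> G (s h, u) has derivative h times the partial derivative of G
at (s h, u); integrate it from 0 to 1. *)
Lemma FTC_line n (G : 'rV[R]_(1 + n) -> R) (h : R) (u : 'rV[R]_n) :
  (forall s, `[0, 1]%classic s -> differentiable G (consv (s * h) u)) ->
  (forall s, `[0, 1]%classic s -> {for consv (s * h) u, continuous ('D_(consv 1 0) G)}) ->
  h * (\int[mu]_(s in `[0, 1]) 'D_(consv 1 0) G (consv (s * h) u)) =
  G (consv h u) - G (consv 0 u).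
Proof.
move=> dG cDG.
have line (s : R) : consv (s * h) u = consv 0 u + s *: (h *: consv 1 0).
  by rewrite -!consvZ -consvD !scaler0 mulr1 addr0 add0r.
have dF (s : R) : `[0, 1]%classic s ->
    is_derive s (1 : R) (fun s : R => G (consv (s * h) u))
      (h * 'D_(consv 1 0) G (consv (s * h) u)).
  move=> s01; have dGs := dG s s01.
  have -> : h * 'D_(consv 1 0) G (consv (s * h) u) = 'D_(h *: consv 1 0) G (consv (s * h) u).
    by rewrite !deriveE // linearZ.
  rewrite line in dGs *; under eq_fun do rewrite line.
  exact: is_derive_line.
have cl : continuous (fun s : R => consv (s * h) u).
  move=> s; apply: (cvg_comp (fun s : R => s * h) (fun t => consv t u)); last exact: consv_cvg_l.
  exact: (cvgM cvg_id (cvg_cst h)).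
have cF : {within `[0, 1], continuous (fun s : R => 'D_(consv 1 0) G (consv (s * h) u))}.
  apply: continuous_in_subspaceT => s; rewrite inE => s01.
  exact: (cvg_comp _ _ (cl s) (cDG s s01)).
rewrite -RintegralZl //; last first.
  apply: continuous_compact_integrable => //; exact: segment_compact.
have chF : {within `[0, 1], continuous (fun s : R => h * 'D_(consv 1 0) G (consv (s * h) u))}.
  apply: continuous_in_subspaceT => s; rewrite inE => s01.
  exact: (cvgM (cvg_cst h) (cvg_comp _ _ (cl s) (cDG s s01))).
have cG (s : R) : `[0, 1]%classic s -> {for s, continuous (fun s : R => G (consv (s * h) u))}.
  move=> s01.
  exact: (cvg_comp _ _ (cl s) (differentiable_continuous (dG s s01))).
have i0 : `[0, 1]%classic (0 : R) by rewrite /= in_itv /= lexx ler01.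
have i1 : `[0, 1]%classic (1 : R) by rewrite /= in_itv /= lexx ler01.
rewrite /Rintegral (continuous_FTC2 (F := fun s : R => G (consv (s * h) u))) //=.
- by rewrite mul1r mul0r.
- split.
  + move=> s s01; have [] // := dF s; exact: subset_itv_oo_cc.
  + exact/cvg_at_right_filter/cG.
  + exact/cvg_at_left_filter/cG.
- move=> s s01; rewrite derive1E; have [] // := dF s; exact: subset_itv_oo_cc.
Qed.

(** By [FTC_line] the quotient is the integral over s in [0, 1] of the partial
derivative of G at (s z_0, z'), where z = (z_0, z'). The star-shapedness of U in the
first variable keeps the points (s z_0, z') in U. *)
Lemma smooth_quotient n (U : set 'rV[R]_(1 + n)) (G : 'rV[R]_(1 + n) -> R) :
  open U ->
  (forall s z, `[0, 1]%classic s -> U z -> U (consv (s * lsubmx z 0 0) (rsubmx z))) ->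
  smooth_on U G -> smooth_on U (quotient G).
Proof.
move=> oU star SG k.
have [dG DG] := SG k.+1.
pose sc (w : 'rV[R]_(1 + (1 + n))) : 'rV[R]_(1 + n) :=
  consv (lsubmx w 0 0 * lsubmx (rsubmx w) 0 0) (rsubmx (rsubmx w)).
have Csc i : Ck i setT sc.
  have oT m := @openT 'rV[R]_m.
  have Cr : Ck i setT (fun w : 'rV[R]_(1 + (1 + n)) => rsubmx w : 'rV[R]_(1 + n)).
    exact: (Ck_rsub i (oT _)).
  have Clr : Ck i setT (fun w : 'rV[R]_(1 + (1 + n)) => lsubmx (rsubmx w : 'rV[R]_(1 + n)) 0 0).
    exact: (Ck_comp (oT _) _ Cr (Ck_lsub i (oT _))).
  have Crr : Ck i setT (fun w : 'rV[R]_(1 + (1 + n)) =>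
      rsubmx (rsubmx w : 'rV[R]_(1 + n)) : 'rV[R]_n).
    exact: (Ck_comp (oT _) _ Cr (Ck_rsub i (oT _))).
  exact: (Ck_consv (oT _) (Ck_scale (oT _) (Ck_lsub i (oT _)) Clr) Crr).
pose W := sc @^-1` U.
have oW : open W.
  by apply: open_comp => // w _; exact: (Csc 0%N).
have CK : Ck k W ('D_(consv 1 0) G \o sc).
  apply: (Ck_comp (U := U)) => //; first by apply: Ck_sub (Csc k).
  exact: DG.
apply: (Ck_eq oU _ (Ck_param_int oU _ CK)) => [z Uz|s z s01 Uz]; last first.
  by rewrite /W /sc /= consvE row_mxKr; exact: star.
have KE : param_int ('D_(consv 1 0) G \o sc) z =
    \int[mu]_(s in `[0, 1]) 'D_(consv 1 0) G (consv (s * lsubmx z 0 0) (rsubmx z)).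
  by apply: eq_Rintegral => s _; rewrite /sc /= consvE row_mxKr.
rewrite KE /quotient; case: eqP => [z0|/eqP z0].
  rewrite z0; under eq_Rintegral do rewrite mulr0.
  by rewrite integral01_cst [z in RHS]consv_eta z0.
rewrite [z in G z]consv_eta -FTC_line.
- exact/esym/(mulKf z0).
- by move=> s s01; apply: dG; exact: star.
- by move=> s s01; apply: (Ck_continuous (DG _)); exact: star.
Qed.

Lemma smooth_quotient_row n N (U : set 'rV[R]_(1 + n))
    (G : 'rV[R]_(1 + n) -> 'rV[R]_N) :
  open U ->
  (forall s z, `[0, 1]%classic s -> U z -> U (consv (s * lsubmx z 0 0) (rsubmx z))) ->
  smooth_on U G -> smooth_on U (quotient G).
Proof.
move=> oU star SG k; apply: Ck_row => // j.
have SGj : smooth_on U (fun z => G z 0 j) by move=> i; exact: Ck_coord.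
apply: (Ck_eq oU _ (smooth_quotient oU star SGj k)) => z Uz.
have [dG _] := SG 1%N.
rewrite /quotient; case: ifP => _; last by rewrite !mxE.
by rewrite derive_mx ?mxE //; exact/diff_derivable/dG.
Qed.

End Hadamard.

(** * Plots given by total functions, and germs along them *)

Section PlotOn.
Variable R : realType.
Implicit Types X : diffeology R.

(** Plots that are restrictions of total functions: their composition does not
require membership proofs. *)
Definition plot_on X n (U : set 'rV[R]_n) (P : 'rV[R]_n -> X) : Prop :=
  plot (fun u : U => P (val u)).

Lemma plot_on_open X n (U : set 'rV[R]_n) (P : 'rV[R]_n -> X) :
  plot_on U P -> open U.
Proof. exact: plot_open. Qed.

Lemma plot_on_valL X n (U : set 'rV[R]_n) (p : U -> X) (x : X) :
  plot p -> plot_on U ('valL_x p).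
Proof. by congr plot; apply/funext => u; rewrite valLE. Qed.

Lemma plot_on_eq X n (U : set 'rV[R]_n) (P Q : 'rV[R]_n -> X) :
  (forall z, U z -> P z = Q z) -> plot_on U P -> plot_on U Q.
Proof.
by move=> PQ; congr plot; apply/funext => u; apply: PQ; exact: set_valP.
Qed.

Lemma plot_on_comp X m n (W : set 'rV[R]_m) (U : set 'rV[R]_n)
    (h : 'rV[R]_m -> 'rV[R]_n) (P : 'rV[R]_n -> X) :
  open W -> smooth_on W h -> (forall w, W w -> U (h w)) ->
  plot_on U P -> plot_on W (P \o h).
Proof.
move=> oW Sh WU SP.
pose h' (w : W) : U := SigSub (mem_set (WU _ (set_valP w))).
exact: (plot_comp (h := h') oW ((smoothP oW (fun=> erefl)).1 Sh) SP).
Qed.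

Lemma plot_on_sub X n (W U : set 'rV[R]_n) (P : 'rV[R]_n -> X) :
  open W -> W `<=` U -> plot_on U P -> plot_on W P.
Proof. by move=> oW WU; apply: (plot_on_comp (h := id)) => // k; exact: Ck_id. Qed.

Lemma plot_on_Euclid (V : normedModType R) n (U : set 'rV[R]_n)
    (f : 'rV[R]_n -> V) :
  plot_on (X := Euclid V) U f <-> open U /\ smooth_on U f.
Proof.
have fE (u : U) : f (val u) = (fun u : U => f (val u)) u by [].
by split=> -[oU Sf]; split=> //; [exact/(smoothP oU fE)|exact/(smoothP oU fE)].
Qed.

Lemma plot_on_cst X n (U : set 'rV[R]_n) (x : X) :
  open U -> plot_on U (fun=> x).
Proof. exact: plot_cst. Qed.

End PlotOn.

Section GermsAlongPlots.
Variables (R : realType) (X : diffeology R) (x : X).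
Variables (n : nat) (U : set 'rV[R]_n) (P : 'rV[R]_n -> X) (z0 : 'rV[R]_n).
Hypotheses (SP : plot_on U P) (Uz0 : U z0) (Pz0 : P z0 = x).

Lemma D_open_plot (A : set X) : D_open A -> open (U `&` P @^-1` A).
Proof.
move=> oA; have -> : U `&` P @^-1` A = val @` ((fun u : U => P (val u)) @^-1` A).
  apply/seteqP; split=> [z [Uz Az]|_ [u Au <-]]; last by split=> //; exact: set_valP.
  by have [u uz] := set_typeP Uz; exists u; rewrite //= uz.
exact: oA.
Qed.

Lemma near_D_open (A : set X) : D_open A -> A x -> \forall z \near z0, A (P z).
Proof.
move=> oA Ax; apply: (near_open (D_open_plot oA)) => [|z []//].
by split=> //=; rewrite Pz0.
Qed.

(** The function f is only defined on a D-open set, hence f o P is smooth on the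
open preimage of this set. *)
Lemma smooth_pval (f : pregerm x) :
  smooth_on (U `&` P @^-1` pdom f) (fun z => pval f (P z)).
Proof.
set W := _ `&` _; have oW : open W := D_open_plot (@pdom_open _ _ _ f).
have SW : plot_on W P by apply: plot_on_sub SP => // z [].
have WP (w : W) : P (val w) \in pdom f by apply: mem_set; case: (set_valP w).
have Sf : plot_on (X := Euclid R) W (fun z => pval f (P z)).
  exact: (dsmooth_pval (@subset_refl _ _) (p := fun w : W => SigSub (WP w)) SW).
by have /plot_on_Euclid[] := Sf.
Qed.

Lemma differentiable_pval (f : pregerm x) : differentiable (fun z => pval f (P z)) z0.
Proof.
have [df _] := @smooth_pval f 1%N; apply: df; split=> //=.
rewrite Pz0; exact: pdomx.
Qed.

Lemma near_germ_eq (f g : pregerm x) : germ_of f = germ_of g ->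
  \forall z \near z0, pval f (P z) = pval g (P z).
Proof.
move=> fg; have [A [oA Ax _ fA]] := repr_pi f; have [B [oB Bx _ gB]] := repr_pi g.
apply: filterS2 (near_D_open oA Ax) (near_D_open oB Bx) => z Az Bz.
by rewrite -fA // -gB // fg.
Qed.

End GermsAlongPlots.

(** * The derivation defined by a curve *)

Section Curves.
Variable R : realType.

Lemma open_sym_itv (e : R) : open (sym_itv e).
Proof.
have -> : sym_itv e = (fun t : 'rV[R]_1 => t 0 0) @^-1` [set` `]- e, e[].
  by apply/seteqP; split=> t; rewrite /sym_itv /= in_itv.
by apply: open_comp => [t _|]; [exact: coord_continuous|exact: itv_open].
Qed.

Definition curve_on (X : diffeology R) (e : R) (c : R -> X) :=
  plot_on (sym_itv e) (fun t => c (t 0 0)).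

Lemma plot_on_curve (X : diffeology R) (e : R) (c : R -> X) n
    (W : set 'rV[R]_n) (phi : 'rV[R]_n -> R) :
  open W -> smooth_on W phi -> (forall w, W w -> - e < phi w < e) ->
  curve_on e c -> plot_on W (fun w => c (phi w)).
Proof.
move=> oW Sphi We Sc.
have Sh : smooth_on W (fun w => const_mx (phi w) : 'rV[R]_1).
  move=> k; apply: Ck_row => // j; apply: (Ck_eq oW _ (Sphi k)) => w _.
  by rewrite mxE.
have := plot_on_comp (h := fun w => const_mx (phi w)) oW Sh _ Sc.
move=> /(_ _)/plot_on_eq; apply=> [w Ww|w Ww]; rewrite /sym_itv /= mxE //.
exact: We.
Qed.

Definition curve_at (X : diffeology R) (x : X) (c : R -> X) :=
  c 0 = x /\ exists2 e, 0 < e & curve_on e c.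

(** Representatives of the same germ agree along c near 0, so that the choice of the
representative does not matter, see [vel_plot]. *)
Definition vel (X : diffeology R) (x : X) (c : R -> X) (F : germ x) : R :=
  'D_1 (fun h => pval (repr F) (c h)) 0.

Lemma sym_itv0 (e : R) : 0 < e -> sym_itv e 0.
Proof. by move=> e0; rewrite /sym_itv /= mxE e0 oppr_lt0 e0. Qed.

Section Velocity.
Variables (X : diffeology R) (x : X).

Lemma germP (P : germ x -> Prop) : (forall f, P (germ_of f)) -> forall F, P F.
Proof. by move=> Pf F; rewrite -[F]reprK; exact: Pf. Qed.

(** Near 0 the value of the representative of [f] along P is that of f, and the
derivative along the line h |-> h v is the directional derivative. *)
Lemma vel_plot n (U : set 'rV[R]_n) (P : 'rV[R]_n -> X) (f : pregerm x)
    (v : 'rV[R]_n) : plot_on U P -> U 0 -> P 0 = x ->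
  is_derive (0 : R) (1 : R) (fun h : R => pval f (P (h *: v)))
    ('D_v (fun z => pval f (P z)) 0) /\
  vel (fun h => P (h *: v)) (germ_of f) = 'D_v (fun z => pval f (P z)) 0.
Proof.
move=> SP U0 P0.
have D g := is_derive_line0 v (differentiable_pval SP U0 P0 g).
split; first exact: D.
rewrite /vel; case: (D (repr (germ_of f))) => _ ->.
apply: near_eq_derive; apply: (near_germ_eq SP U0 P0); exact: reprK.
Qed.

Lemma curve_atE (c : R -> X) : curve_at x c ->
  exists (U : set 'rV[R]_1) (P : 'rV[R]_1 -> X),
    [/\ plot_on U P, U 0, P 0 = x & c = fun h => P (h *: const_mx 1)].
Proof.
move=> [c0 [e e0 Sc]]; exists (sym_itv e), (fun t => c (t 0 0)).
split=> //; [exact: sym_itv0|by rewrite mxE|].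
by apply/funext => h; rewrite !mxE mulr1.
Qed.

Lemma vel_is_derive (c : R -> X) (f : pregerm x) : curve_at x c ->
  is_derive (0 : R) (1 : R) (fun h => pval f (c h)) (vel c (germ_of f)).
Proof.
move=> /curve_atE[U [P [SP U0 P0 ->]]].
by have [d ->] := vel_plot f (const_mx 1) SP U0 P0.
Qed.

Lemma velE (c : R -> X) (f : pregerm x) (d : R) : curve_at x c ->
  is_derive (0 : R) (1 : R) (fun h => pval f (c h)) d -> vel c (germ_of f) = d.
Proof. by move=> cx [_ <-]; case: (vel_is_derive f cx). Qed.

Lemma near_curve (c : R -> X) (A : set X) : curve_at x c -> D_open A -> A x ->
  \forall h \near (0 : R), A (c h).
Proof.
move=> /curve_atE[U [P [SP U0 P0 ->]]] oA Ax.
have cv : (fun h : R => h *: const_mx 1 : 'rV[R]_1) @ (0 : R) --> (0 : 'rV[R]_1).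
  rewrite -[X in _ --> X](scale0r (const_mx 1)).
  exact: (cvgZ cvg_id (cvg_cst _)).
exact: (cv _ (near_D_open SP U0 P0 oA Ax)).
Qed.

Lemma vel_derivation (c : R -> X) : curve_at x c -> derivation (vel c : germ x -> R).
Proof.
move=> cx; split=> [a|]; elim/germP=> f; elim/germP=> g.
  rewrite -[a *: germ_of f]/(germ_scale a (germ_of f)) germ_scale_pi.
  rewrite -[_ + _]/(germ_add _ _) germ_add_pi; apply: velE => //.
  have df := vel_is_derive f cx; have dg := vel_is_derive g cx.
  have nf := near_curve cx (@pdom_open _ _ _ f) (pdomx f).
  have ng := near_curve cx (@pdom_open _ _ _ g) (pdomx g).
  apply: near_eq_is_derive (is_deriveD (is_deriveZ a df) dg).
  by apply: filterS2 nf ng => h fh gh; rewrite !mk_pregermE.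
rewrite -[_ * _ in LHS]/(germ_mul _ _) germ_mul_pi !germ_eval_pi.
apply: velE => //.
have df := vel_is_derive f cx; have dg := vel_is_derive g cx.
have nf := near_curve cx (@pdom_open _ _ _ f) (pdomx f).
have ng := near_curve cx (@pdom_open _ _ _ g) (pdomx g).
apply: near_eq_is_derive (is_derive_eq (is_deriveM df dg) _).
  by apply: filterS2 nf ng => h fh gh; rewrite mk_pregermE.
by have [-> _] := cx; rewrite addrC mulrC.
Qed.

Lemma vel_velocity (c : R -> X) : curve_at x c -> velocity (vel c : germ x -> R).
Proof.
move=> cx; have [c0 [e e0 Sc]] := cx.
exists e, (fun t : sym_itv e => c (val t 0 0)); split=> // [t ->|f].
  by rewrite mxE.
apply: near_eq_is_derive (vel_is_derive f cx).
have ne : \forall h \near (0 : R), - e < h < e.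
  by have := @near_in_itvoo R (- e) e 0; rewrite in_itv /= oppr_lt0 e0; apply.
apply: filterS ne => h eh; congr pval.
have [t th] : exists t : sym_itv e, val t = const_mx h.
  by apply: set_typeP; rewrite /sym_itv /= mxE.
by rewrite -th valLE th mxE.
Qed.

(** The representing plot, continued by x, is a curve; a derivation is
determined by the derivatives it stands for. *)
Lemma velocity_vel (v : germ x -> R) : velocity v ->
  exists2 c, curve_at x c & v = vel c.
Proof.
move=> [e [p [e0 Sp px vp]]].
suff cx : curve_at x (fun h => 'valL_x p (const_mx h)).
  exists (fun h => 'valL_x p (const_mx h)) => //.
  by apply/funext; elim/germP => f; apply/esym/velE.
have E (t : 'rV[R]_1) : const_mx (t 0 0) = t.
  by apply/matrixP => i j; rewrite mxE !ord1.
split.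
  have [t t0] := set_typeP (sym_itv0 e0).
  rewrite (_ : const_mx 0 = 0); last by apply/matrixP => i j; rewrite !mxE.
  by rewrite -t0 valLE px.
exists e => //; rewrite /curve_on; apply: plot_on_eq (plot_on_valL x Sp) => t _.
by rewrite E.
Qed.

End Velocity.
End Curves.

Section TangentOfCurve.
Variables (R : realType) (X : diffeology R) (x : X).

(** Locally a plot of germs lifts to a plot w |-> q w of [A, R] for one D-open set A.
Then K (h, w) = q w (c h) is smooth where it is defined, an open neighbourhood of
all (0, w), and the value of [vel c] is its partial derivative in h at (0, w). *)
Lemma vel_smooth (c : R -> X) : curve_at x c ->
  @dsmooth _ (germ_space x) (Euclid R) (vel c).
Proof.
move=> cx n U p [oU Gp]; split=> //; apply: smooth_local => // u.
have [W [WU [A [oA [Ax [q [oW Wu [_ Sq] pq]]]]]]] := Gp u.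
exists W, WU; split=> //.
have [c0 [e e0 Sc]] := cx.
pose Z1 := [set z : 'rV[R]_(1 + n) | - e < lsubmx z 0 0 < e /\ W (rsubmx z)].
have oZ1 : open Z1 by exact: open_slab.
have SZ1 : plot_on Z1 (fun z => c (lsubmx z 0 0)).
  apply: plot_on_curve Sc => // [k|z []//]; exact: Ck_lsub.
pose Z := Z1 `&` (fun z => c (lsubmx z 0 0)) @^-1` A.
have oZ : open Z := D_open_plot SZ1 oA.
pose K (z : 'rV[R]_(1 + n)) : R :=
  'valL_0 (fun w : W => 'valL_(0 : R) (q w) (c (lsubmx z 0 0))) (rsubmx z).
have ZW (z : Z) : rsubmx (val z) \in W.
  by apply: mem_set; have [[]] := set_valP z.
have ZA (z : Z) : c (lsubmx (val z) 0 0) \in A.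
  by apply: mem_set; have [] := set_valP z.
have SK : smooth_on Z K.
  pose r (z : Z) : dprod (dsub (X := Euclid 'rV[R]_n) W) (dsub A) :=
    (SigSub (ZW z), SigSub (ZA z)).
  have Sr : plot r.
    split=> /=.
      apply: (plot_on_Euclid Z (fun z => rsubmx z)).2; split=> // k.
      exact: Ck_rsub.
    by apply: (plot_on_sub oZ) SZ1 => z [].
  have [_ SqZ] := Sq _ _ _ Sr.
  apply: (smoothP (g := K) oZ _).2 SqZ => z.
  rewrite /K -[rsubmx (val z)]/(val (SigSub (ZW z) : W)) valLE.
  by rewrite -[c _]/(val (SigSub (ZA z) : A)) valLE.
have Z0 (w : 'rV[R]_n) : W w -> Z (consv 0 w).
  move=> Ww; split; last by rewrite /= consvE c0.
  by split; rewrite ?consvE ?row_mxKr // oppr_lt0 e0.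
have SD : smooth_on W (fun w => 'D_(consv 1 0) K (consv 0 w)).
  move=> k; have [_ /(_ (consv 1 0)) DK] := SK k.+1.
  apply: (Ck_comp (h := fun w => consv 0 w) oW Z0 _ DK).
  by apply: Ck_consv => //; [exact: Ck_cst|exact: Ck_id].
apply: (smoothP oW _).1 SD => w.
rewrite /= pq; apply/esym/velE => //.
have dK : differentiable K (consv 0 (val w)).
  by have [dK _] := SK 1%N; apply/dK/Z0/set_valP.
have := is_derive_line (t := 0) (v := consv 1 0) (x := consv 0 (val w)).
rewrite scale0r addr0 => /(_ _ _ dK).
congr is_derive; apply/funext => h.
rewrite -consvZ -consvD scaler0 addr0 add0r mulr1 /K consvE row_mxKr valLE //.
Qed.

Lemma vel_tangent (c : R -> X) : curve_at x c -> tangent_vector (vel c : germ x -> R).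
Proof.
move=> cx; have cd := vel_derivation cx.
split=> //; first exact: vel_smooth.
exists 1%N, (fun=> 1), (fun=> vel c); split=> [i|F]; last by rewrite big_ord1 mul1r.
by split=> //; exact: vel_velocity.
Qed.

End TangentOfCurve.

(** * Spaces parametrized by a vector space *)

Section LinearChart.
Variables (R : realType) (X : diffeology R) (x : X) (E : lmodType R).

(** A parametrization of X by the vector space E, with 0 sent to x. The space E has
no diffeology of its own: its plots are the maps which tr carries to plots. *)
Record linear_chart (tr : E -> X) (tl : X -> E) : Prop := LinearChart {
  chart0 : tr 0 = x;
  chartK : cancel tr tl;
  chart_plot : forall n (U : set 'rV[R]_n) (a : 'rV[R]_n -> R)
    (p q : 'rV[R]_n -> E), smooth_on U a ->
    plot_on U (tr \o p) -> plot_on U (tr \o q) ->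
    plot_on U (fun z => tr (a z *: p z + q z));
  chart_sep : forall e : E,
    (forall l : {scalar E}, dsmooth (l \o tl : X -> Euclid R) -> l e = 0) ->
    e = 0;
  chart_hadamard : forall (r : R) (c : R -> X), 0 < r -> curve_on r c -> c 0 = x ->
    exists2 s : R -> E, curve_on r (tr \o s) &
      forall h, - r < h < r -> c h = tr (h *: s h)
}.

Variables (tr : E -> X) (tl : X -> E).
Hypothesis ch : linear_chart tr tl.

Let plot_cstE (e : E) n (U : set 'rV[R]_n) (oU : open U) :
  plot_on U (tr \o cst e) := plot_on_cst (tr e) oU.

Let line (e : E) (h : R) : X := tr (h *: e).

Lemma plot_plane (e1 e2 : E) :
  plot_on setT (fun z : 'rV[R]_2 => tr (z 0 0 *: e1 + z 0 1 *: e2)).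
Proof.
have oT := @openT 'rV[R]_2.
have Sc i : smooth_on setT (fun z : 'rV[R]_2 => z 0 i) by move=> k; exact: Ck_coordinate.
have S2 : plot_on setT (fun z : 'rV[R]_2 => tr (z 0 1 *: e2)).
  have := chart_plot ch (p := cst e2) (q := cst 0) (Sc 1) (plot_cstE _ oT) (plot_cstE _ oT).
  by apply: plot_on_eq => z _; rewrite addr0.
exact: (chart_plot ch (p := cst e1) (q := fun z => z 0 1 *: e2) (Sc 0) (plot_cstE _ oT) S2).
Qed.

Let vec2 (a b : R) : 'rV[R]_2 := \row_i (if i == 0 then a else b).

Let vec2E a b : (vec2 a b 0 0 = a) * (vec2 a b 0 1 = b).
Proof. by split; rewrite mxE. Qed.

Lemma line_curve_at (e : E) : curve_at x (line e).
Proof.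
split; first by rewrite /line scale0r (chart0 ch).
exists 1 => //; rewrite /curve_on.
have oI := @open_sym_itv R 1.
have := chart_plot ch (U := sym_itv 1) (a := fun t => t 0 0) (p := cst e) (q := cst 0)
   (fun k => Ck_coordinate k 0 oI) (plot_cstE _ oI) (plot_cstE _ oI).
by apply: plot_on_eq => t _; rewrite addr0.
Qed.

(** The lines through x in the plane spanned by e1 and e2 lie on one plot of
dimension two, along which f is differentiable. *)
Lemma vel_line_linear (a : R) (e1 e2 : E) (F : germ x) :
  vel (line (a *: e1 + e2)) F = a * vel (line e1) F + vel (line e2) F.
Proof.
elim/germP: F => f; set P := fun z : 'rV[R]_2 => tr (z 0 0 *: e1 + z 0 1 *: e2).
have SP : plot_on setT P := plot_plane e1 e2.
have P0 : P 0 = x by rewrite /P !mxE !scale0r addr0 (chart0 ch).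
have D v := (vel_plot f v SP I P0).2.
have lineE b c : line (b *: e1 + c *: e2) = fun h => P (h *: vec2 b c).
  apply/funext => h; rewrite /P [(_ *: vec2 _ _) _ 0]mxE [(_ *: vec2 _ _) _ 1]mxE !vec2E.
  by rewrite /line scalerDr !scalerA.
have df := differentiable_pval SP I P0 f.
have -> : a *: e1 + e2 = a *: e1 + 1 *: e2 by rewrite scale1r.
have -> : line e1 = line (1 *: e1 + 0 *: e2) by rewrite scale1r scale0r addr0.
have -> : line e2 = line (0 *: e1 + 1 *: e2) by rewrite scale1r scale0r add0r.
rewrite !lineE !D !deriveE // -[a * _]linearZ -linearD; congr ('d _ _ _).
apply/rowP => i; rewrite !mxE.
by case: (i == 0); ring.
Qed.

Definition chart_tangent (e : E) : tangent x :=
  Tangent (asboolT (vel_tangent (line_curve_at e))).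

Lemma chart_tangent_linear : linear chart_tangent.
Proof.
move=> a e1 e2; apply: val_inj; apply/funext => F /=.
exact: vel_line_linear.
Qed.

Lemma chart_tangent_derive (e : E) (f : pregerm x) :
  is_derive (0 : R) (1 : R) (fun h => pval f (tr (h *: e))) (chart_tangent e (germ_of f)).
Proof. exact/vel_is_derive/line_curve_at. Qed.

(** A functional l that is smooth on X defines a germ whose derivative along the line
of e is l e. *)
Lemma chart_tangent_eq0 (e : E) : chart_tangent e = 0 -> e = 0.
Proof.
move=> De; apply: (chart_sep ch) => l Sl.
have Sf : @dsmooth _ (dsub [set: X]) (Euclid R) (fun y => l (tl (val y))).
  by move=> n U p Sp; exact: (Sl n U (fun u => val (p u)) Sp).
pose f := mk_pregerm (x := x) (f := fun y => l (tl y)) (@D_openT _ X) I Sf.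
have := chart_tangent_derive e f; rewrite De.
have -> : (fun h => pval f (tr (h *: e))) = l e \*o id.
  by apply/funext => h; rewrite mk_pregermE // (chartK ch) linearZ /= mulrC.
by move=> [_]; rewrite deriveMl ?derive_id ?mulr1 //; exact: derivable_id.
Qed.

(** Hadamard's lemma puts c on the diagonal of the plot (y, z) |-> tr (y s(z)), which
is constant on the axis y = 0 and is the line of s 0 on the axis z = 0. *)
Lemma vel_curve (c : R -> X) : curve_at x c -> exists e : E,
  (vel c : germ x -> R) = vel (line e).
Proof.
move=> [c0 [r r0 Sc]]; have [s Ss cs] := chart_hadamard ch r0 Sc c0.
exists (s 0); apply/funext; elim/germP => f.
pose U := [set z : 'rV[R]_2 | - r < z 0 1 < r].
have oU : open U.
  have -> : U = (fun z => z 0 1) @^-1` [set` `]- r, r[].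
    by apply/seteqP; split=> z; rewrite /U /= in_itv.
  by apply: open_comp => [z _|]; [exact: coord_continuous|exact: itv_open].
have Sc' i : smooth_on U (fun z => z 0 i) by move=> k; exact: Ck_coordinate.
pose P (z : 'rV[R]_2) : X := tr (z 0 0 *: s (z 0 1)).
have SP : plot_on U P.
  have := chart_plot ch (p := fun z => s (z 0 1)) (q := cst 0) (Sc' 0)
    (plot_on_curve oU (Sc' 1) (fun _ h => h) Ss) (plot_cstE _ oU).
  by apply: plot_on_eq => z _; rewrite addr0.
have U0 : U 0 by rewrite /U /= mxE r0 oppr_lt0 r0.
have P0 : P 0 = x by rewrite /P !mxE scale0r (chart0 ch).
have D v := (vel_plot f v SP U0 P0).2.
have df := differentiable_pval SP U0 P0 f.
have PE h b d : P (h *: vec2 b d) = tr ((h * b) *: s (h * d)).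
  by rewrite /P [(_ *: vec2 _ _) _ 0]mxE [(_ *: vec2 _ _) _ 1]mxE !vec2E.
have nr : \forall h \near (0 : R), - r < h < r.
  by have := @near_in_itvoo R (- r) r 0; rewrite in_itv /= oppr_lt0 r0; apply.
have -> : vel c (germ_of f) = vel (fun h => P (h *: vec2 1 1)) (germ_of f).
  apply: near_eq_derive; apply: filterS nr => h /cs ->.
  by rewrite PE mulr1.
have -> : line (s 0) = fun h => P (h *: vec2 1 0).
  by apply/funext => h; rewrite PE mulr1 mulr0.
have D01 : 'D_(vec2 0 1) (fun z => pval f (P z)) 0 = 0.
  rewrite -D /vel (_ : (fun h => _) = cst (pval (repr (germ_of f)) x)) ?derive_cst //.
  by apply/funext => h; rewrite PE mulr0 scale0r (chart0 ch).
rewrite !D; move: D01; rewrite !deriveE // => D01.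
have -> : vec2 1 1 = vec2 1 0 + vec2 0 1.
  by apply/rowP => i; rewrite !mxE; case: (i == 0); rewrite ?addr0 ?add0r.
by rewrite linearD D01 addr0.
Qed.

Lemma chart_tangent_surj (v : tangent x) : exists e, chart_tangent e = v.
Proof.
have /asboolP[_ _ [k [c [w [wP vE]]]]] := tangentP v.
have /choice[e eP] : forall i, exists e, w i = chart_tangent e.
  by move=> i; have [_ /velocity_vel[d /vel_curve[e de] ->]] := wP i; exists e.
exists (\sum_i c i *: e i).
pose Dm := GRing.isLinear.Build R E (tangent x) *:%R _ chart_tangent_linear.
pose D : {linear E -> tangent x} := HB.pack chart_tangent Dm.
apply: val_inj; apply/funext => F.
change (tfun (D (\sum_i c i *: e i)) F = tfun v F); rewrite linear_sum.
rewrite [RHS]vE (big_morph (fun T : tangent x => T F) (id1 := 0) (op1 := +%R)) //.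
by apply: eq_bigr => i _; rewrite linearZ eP.
Qed.

Theorem linear_chart_iso : exists D : {linear E -> tangent x},
  bijective D /\ forall (e : E) (f : pregerm x),
    is_derive (0 : R) (1 : R) (fun h => pval f (tr (h *: e))) (D e (germ_of f)).
Proof.
pose Dm := GRing.isLinear.Build R E (tangent x) *:%R _ chart_tangent_linear.
pose D : {linear E -> tangent x} := HB.pack chart_tangent Dm.
exists D; split; last exact: chart_tangent_derive.
have [inv invP] := choice chart_tangent_surj.
exists inv => [e|//]; apply/eqP; rewrite -subr_eq0; apply/eqP.
apply: chart_tangent_eq0; change (D (inv (D e) - e) = 0).
by rewrite linearB /= invP subrr.
Qed.

End LinearChart.

(** * Path spaces *)

Section PathPlots.
Variables (R : realType) (N : nat) (a b : R).
Local Notation seg := (segment a b).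
Local Notation P := (path_space N a b).

Definition ev (g : paths N a b) (t : seg) : 'rV[R]_N := (g : dmap _ _) t.

Lemma evD (g h : paths N a b) t : ev (g + h) t = ev g t + ev h t.
Proof. by []. Qed.
Lemma evZ c (g : paths N a b) t : ev (c *: g) t = c *: ev g t.
Proof. by []. Qed.
Lemma evB (g h : paths N a b) t : ev (g - h) t = ev g t - ev h t.
Proof. by []. Qed.
Lemma ev_inj (g h : paths N a b) : ev g =1 ev h -> g = h.
Proof. by move=> gh; apply: val_inj; apply/funext. Qed.

(** The plots Z -> [a, b] need not be restrictions of maps to [a, b] defined
everywhere, hence t is left as a function on the subtype. *)
Lemma path_plot_onP n (U : set 'rV[R]_n) (p : 'rV[R]_n -> paths N a b) :
  plot_on (X := P) U p <-> open U /\
  forall m (Z : set 'rV[R]_m) (h : 'rV[R]_m -> 'rV[R]_n) (t : Z -> seg),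
    smooth_on Z h -> (forall z, Z z -> U (h z)) -> plot t ->
    smooth (fun z : Z => ev (p (h (val z))) (t z)).
Proof.
split=> -[oU Sp]; split=> // m Z q.
  move=> t Sh ZU St; have [oZ _] := St.
  have Uq (z : Z) : q (val z) \in U by apply/mem_set/ZU/set_valP.
  have := Sp m Z (fun z => (SigSub (Uq z), t z)).
  case=> //; split=> //=.
  by split=> //; exact: (smoothP oZ (fun=> erefl)).1 Sh.
move=> [q1 q2]; have [oZ Sq1] := q1; split=> //.
have := Sp m Z ('valL_0 (fun z => val (q z).1)) (fun z => (q z).2) Sq1 _ q2.
have -> : (fun z : Z => ev (p ('valL_0 (fun z => val (q z).1) (val z))) (q z).2) =
   (fun ux => p (val ux.1) ux.2) \o q by apply/funext => z; rewrite valLE.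
apply=> z Zz; have [w <-] := set_typeP Zz; rewrite valLE; exact: set_valP.
Qed.

End PathPlots.

Section PathHadamard.
Variables (R : realType) (N : nat) (a b : R).
Local Notation seg := (segment a b).
Local Notation P := (path_space N a b).

Lemma path_plot_comb n (U : set 'rV[R]_n) (k : 'rV[R]_n -> R)
    (p q : 'rV[R]_n -> paths N a b) : smooth_on U k ->
  plot_on (X := P) U p -> plot_on (X := P) U q ->
  plot_on (X := P) U (fun z => k z *: p z + q z).
Proof.
move=> Sk /path_plot_onP[oU Sp] /path_plot_onP[_ Sq].
apply/path_plot_onP; split=> // m Z h t Sh ZU St; have [oZ _] := St.
have Skh : smooth (fun z : Z => k (h (val z))).
  apply: (smoothP (g := k \o h) oZ _).1 => // i.
  exact: (Ck_comp oZ ZU (Sh i) (Sk i)).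
exact: (smoothD oZ (smoothZ oZ Skh (Sp _ _ _ _ Sh ZU St)) (Sq _ _ _ _ Sh ZU St)).
Qed.

Variables (r : R) (c : R -> paths N a b).
Hypotheses (r0 : 0 < r) (Sc : curve_on (X := P) r c).

Let q (h : R) (t : seg) : 'rV[R]_N :=
  if h == 0 then 'D_1 (fun h => ev (c h) t) 0
  else h^-1 *: (ev (c h) t - ev (c 0) t).

(** Hadamard's lemma for G (h, z) = c h (t z), which is smooth in finitely many
variables since c is a plot. *)
Lemma smooth_path_quotient m (Z : set 'rV[R]_m) (h : 'rV[R]_m -> R) (t : Z -> seg) :
  smooth_on Z h -> (forall z, Z z -> - r < h z < r) -> plot t ->
  smooth (fun z : Z => q (h (val z)) (t z)).
Proof.
move=> Sh Zr St; have [oZ _] := St.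
pose U := [set w : 'rV[R]_(1 + m) | - r < lsubmx w 0 0 < r /\ Z (rsubmx w)].
have oU : open U by exact: open_slab.
pose G (w : 'rV[R]_(1 + m)) : 'rV[R]_N :=
  'valL_0 (fun z : Z => ev (c (lsubmx w 0 0)) (t z)) (rsubmx w).
have GE h' (z : Z) : G (consv h' (val z)) = ev (c h') (t z).
  by rewrite /G consvE row_mxKr valLE.
have SG : smooth_on U G.
  have UZ (w : U) : rsubmx (val w) \in Z by apply: mem_set; case: (set_valP w).
  have [_ Scc] := (path_plot_onP _ _).1 (plot_on_curve oU
     (fun k => Ck_lsub k oU) (fun w => @proj1 _ _) Sc).
  have St' : plot (fun w : U => t (SigSub (UZ w))).
    apply: (plot_comp (h := fun w : U => SigSub (UZ w)) oU _ St) => /=.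
    by apply: (smoothP (g := fun w => rsubmx w) oU _).1 => // k; exact: (Ck_rsub k oU).
  have := Scc _ U id _ (fun k => Ck_id k oU) (fun w Uw => Uw) St'.
  apply: (smoothP (g := G) oU _).2 => w.
  by rewrite /G -[rsubmx (val w)]/(val (SigSub (UZ w) : Z)) valLE.
have SQ : smooth_on U (quotient G).
  apply: smooth_quotient_row => // s w; rewrite /= in_itv /= => /andP[s0 s1].
  move=> [wr wZ]; split; last by rewrite row_mxKr.
  rewrite consvE; move: wr => /andP[w1 w2]; apply/andP; split; nra.
apply: (smoothP (g := fun z => quotient G (consv (h z) z)) oZ _).1 => [z|k].
  rewrite /quotient /q consvE row_mxKr !GE; case: eqP => // ->.
  rewrite derive_consv1 (_ : (fun h' : R => G (consv h' (val z))) =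
    fun h' => ev (c h') (t z)) //.
  by apply/funext => h'; exact: GE.
apply: (Ck_comp oZ _ _ (SQ k)) => [z Zz|].
  by split; rewrite ?consvE ?row_mxKr //; exact: Zr.
exact: (Ck_consv oZ (Sh k) (Ck_id k oZ)).
Qed.

Lemma dsmooth_quotient h : - r < h < r ->
  dsmooth (q h : seg -> Euclid 'rV[R]_N).
Proof.
move=> hr n U t St; have [oU _] := St; split=> //.
by apply: (smooth_path_quotient (h := cst h)) => // k; exact: Ck_cst.
Qed.

(** The last clause is what keeps s among the loops when c runs through paths with
fixed ends: a value of c h independent of h contributes 0 to the quotient. *)
Lemma path_hadamard : exists s : R -> paths N a b,
  [/\ curve_on (X := P) r s,
      forall h, - r < h < r -> c h = c 0 + h *: s h &
      forall t v, (forall h, - r < h < r -> ev (c h) t = v) ->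
        forall h, ev (s h) t = 0].
Proof.
pose s h : paths N a b := match pselect (- r < h < r) with
  | left hr => DMap (asboolT (dsmooth_quotient hr))
  | right _ => 0 end.
have sE h t : - r < h < r -> ev (s h) t = q h t.
  by move=> hr; rewrite /s; case: pselect.
have r00 : - r < 0 < r by rewrite oppr_lt0 r0.
exists s; split.
- have oI := @open_sym_itv R r.
  apply/path_plot_onP; split=> // m Z h t Sh ZI St; have [oZ _] := St.
  have Sh0 : smooth_on Z (fun z => h z 0 0) by move=> k; exact: Ck_coord.
  have := smooth_path_quotient Sh0 ZI St; congr smooth; apply/funext => z.
  by rewrite sE //; apply/ZI/set_valP.
- move=> h hr; apply: ev_inj => t; rewrite evD evZ sE // /q.
  case: eqP => [->|/eqP h0]; first by rewrite scale0r addr0.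
  by rewrite scalerA divff // scale1r addrC subrK.
- move=> t v cv h; case: (boolP (- r < h < r)) => [hr|/negP hr]; last first.
    by rewrite /s; case: pselect.
  rewrite sE // /q !cv // subrr scaler0; case: eqP => // _.
  rewrite -(derive_cst v (0 : R) 1); apply: near_eq_derive.
  have := @near_in_itvoo R (- r) r 0; rewrite in_itv /= => /(_ r00).
  by apply: filterS => h' /cv.
Qed.

End PathHadamard.

Section BoundaryConditions.
Variables (R : realType) (N : nat) (a b : R).
Local Notation seg := (segment a b).
Local Notation P := (path_space N a b).
(** X is the space of paths with the values of g at the points of T, E the space of
paths vanishing at these points; j and i are the inclusions. *)
Variables (T : set seg) (X : diffeology R) (j : X -> paths N a b) (g : X).
Variables (E : lmodType R) (i : {linear E -> paths N a b}).
Variables (tr : E -> X) (tl : X -> E).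
Hypothesis j_plot : forall n (U : set 'rV[R]_n) (p : 'rV[R]_n -> X),
  plot_on U p <-> plot_on (X := P) U (j \o p).
Hypothesis j_inj : injective j.
Hypothesis i_inj : injective i.
Hypothesis i_range : forall eta : paths N a b,
  (exists e, i e = eta) <-> forall t, T t -> ev eta t = 0.
Hypothesis trE : forall e, j (tr e) = j g + i e.
Hypothesis tlE : forall y, i (tl y) = j y - j g.

Lemma smooth_ev (t : seg) (k : 'I_N) :
  dsmooth (fun y : X => ev (j y) t 0 k : Euclid R).
Proof.
move=> n U p Sp; have oU := plot_open Sp; split=> //.
have /j_plot/path_plot_onP[_ Sj] := plot_on_valL g Sp.
have := Sj _ U id (fun=> t) (fun l => Ck_id l oU) (fun _ Uz => Uz) (plot_cst _ oU).
move=> Sev.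
apply: (smoothP (g := fun z =>
  ('valL_0 (fun z : U => ev (j ('valL_g p (val z))) t) z) 0 k) oU _).1.
  by move=> u; rewrite !valLE.
by move=> l; exact: (Ck_coord k oU (Sev l)).
Qed.

(** Each requirement is read off path by path: linear combinations of plots are plots,
evaluations separate paths, and Hadamard's lemma for paths respects the conditions
at the points of T. *)
Lemma translation_chart : linear_chart g tr tl.
Proof.
have cstP n (U : set 'rV[R]_n) (x : paths N a b) : open U -> plot_on (X := P) U (fun=> x).
  exact: plot_cst.
split.
- by apply: j_inj; rewrite trE linear0 addr0.
- by move=> e; apply: i_inj; rewrite tlE trE addrC addKr.
- move=> n U k p q Sk Sp Sq; have oU := plot_on_open Sp.
  have Sp' := (j_plot _ _).1 Sp; have Sq' := (j_plot _ _).1 Sq.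
  apply/j_plot.
  (* g + (k p + q) = k (g + p) + (- k g + (g + q)) *)
  have SNk : smooth_on U (fun z => - k z).
    move=> l; have := CkZ (-1) oU (Sk l).
    by apply: (Ck_eq oU) => z _; rewrite -[LHS]/(-1 * k z) mulN1r.
  have := path_plot_comb Sk Sp' (path_plot_comb SNk (cstP _ _ (j g) oU) Sq').
  apply: plot_on_eq => z _ /=.
  rewrite !trE scalerDr scaleNr [i (_ + _)]linearD [i (_ *: _)]linearZ /=.
  by rewrite addrA [X in X + _]addrAC subrr add0r addrCA.
- move=> e le; apply: i_inj; rewrite linear0; apply: ev_inj => t.
  apply/rowP => k.
  have lin : scalar (fun e => ev (i e) t 0 k).
    by move=> c e1 e2 /=; rewrite linearD linearZ evD evZ !mxE.
  pose lm := GRing.isLinear.Build R E R *%R _ lin.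
  pose l : {scalar E} := HB.pack (fun e => ev (i e) t 0 k) lm.
  have := le l; rewrite [X in X = 0](_ : _ = ev (i e) t 0 k) // => ->; first by rewrite mxE.
  move=> n U p Sp; have oU := plot_open Sp.
  have [_ S1] := smooth_ev t k Sp; split=> //.
  have := smoothD oU S1 (smooth_cst (- (ev (j g) t 0 k)) oU).
  congr smooth; apply/funext => u /=.
  by rewrite /l /= tlE evB !mxE.
- move=> r c r0 Sc c0.
  have [s [Ss sE s0]] := path_hadamard (c := j \o c) r0 ((j_plot _ _).1 Sc).
  have /choice[e eE] : forall h, exists e, i e = s h.
    move=> h; apply/i_range => t Tt; apply: (s0 t (ev (j g) t)) => h' _ /=.
    rewrite -[j (c h')](subrK (j g)) -tlE evD.
    by rewrite (i_range _).1 ?add0r //; exists (tl (c h')).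
  exists e; last first.
    move=> h hr; apply: j_inj; rewrite trE linearZ /= eE -c0.
    exact: sE.
  apply/j_plot; have oI := @open_sym_itv R r.
  have S1 : smooth_on (sym_itv r) (cst (1 : R)) by move=> k; exact: Ck_cst.
  have := path_plot_comb (p := fun t => s (t 0 0)) S1 Ss (cstP _ _ (j g) oI).
  by apply: plot_on_eq => t _ /=; rewrite trE eE scale1r addrC.
Qed.

End BoundaryConditions.

Theorem theorem3p6 (R : realType) (N : nat) (a b : R) (p q : 'rV[R]_N)
    (hN : (1 <= N)%N) (ab : a < b) :
  (forall g : path_space N a b,
    exists D : {linear paths N a b -> tangent g},
      bijective D /\
      forall (eta : paths N a b) (f : pregerm g),
        is_derive (0 : R) (1 : R) (fun h : R => pval f (line g eta h))
          (D eta (germ_of f)))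
  /\
  (forall g : fixed_path_space ab p q,
    exists D : {linear loops0 N ab -> tangent g},
      bijective D /\
      forall (eta : loops0 N ab) (f : pregerm g),
        is_derive (0 : R) (1 : R) (fun h : R => pval f (fixed_line g eta h))
          (D eta (germ_of f))).
Proof.
split=> g.
  have ch : linear_chart g
      (fun eta : paths N a b => (g : paths N a b) + eta : path_space N a b)
      (fun y => (y : paths N a b) - (g : paths N a b)).
    apply: (@translation_chart R N a b set0 (path_space N a b) id g _
      (@idfun (paths N a b))) => //.
    by move=> eta; split=> // _; exists eta.
  exact: linear_chart_iso ch.
have vK (y : fixed_path_space ab p q) :
    (val y : paths N a b) - (val g : paths N a b) \in fixed_ends ab 0 0.
  have [ya yb] := set_valP y; have [ga gb] := set_valP g.
  rewrite inE; split.
    change (ev (val y) (left_end ab) - ev (val g) (left_end ab) = 0).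
    by rewrite [ev _ _]ya [ev _ _]ga subrr.
  change (ev (val y) (right_end ab) - ev (val g) (right_end ab) = 0).
  by rewrite [ev _ _]yb [ev _ _]gb subrr.
have ch : linear_chart g (fun eta : loops0 N ab => fixed_line g eta 1)
    (fun y => SigSub (vK y) : loops0 N ab).
  pose i : {linear loops0 N ab -> paths N a b} := \val.
  apply: (@translation_chart R N a b [set left_end ab; right_end ab]
    (fixed_path_space ab p q) (fun y => val y) g (loops0 N ab) i).
  - by [].
  - by move=> y z; exact: val_inj.
  - by move=> y z; exact: val_inj.
  - move=> eta; split=> [[e <-] t|e0].
      have [ea eb] := set_valP e; by case=> ->.
    have eP : eta \in fixed_ends ab 0 0.
      by rewrite inE; split; apply: e0; [left|right].
    by exists (SigSub eP : loops0 N ab).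
  - by move=> e; rewrite /= /line scale1r.
  - by [].
have [D [bD DE]] := linear_chart_iso ch.
exists D; split; first exact: bD.
move=> eta f; have := DE eta f.
have -> : (fun h : R => pval f (fixed_line g (h *: eta) 1)) =
    (fun h : R => pval f (fixed_line g eta h)).
  apply/funext => h; congr pval; apply: val_inj.
  change (line (val g) (\val (h *: eta)) 1 = line (val g) (\val eta) h).
  by rewrite /line scale1r.
exact.
Qed.
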